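(* Let $P$ be a convex pentagon in the affine plane $\mathbb{R}^2$ (so $n=5$). Then the following four conditions are equivalent: (1) All successive images $S(P), S^2(P), S^3(P),\dots$ of $P$ under the inverse pentagram map $S$ are convex polygons in the affine plane. (2) The vector $d_P := \sum_{i=1}^5 \frac{d_i}{\mathcal A_i}\in\mathbb{R}^2$ is zero. (3) Glick's operator $G_P\colon\mathbb{R}^3\to\mathbb{R}^3$, regarded as a projective mapping of $\mathbb{P}^2$, is affine. (4) The conic inscribed in $P$ and the conic circumscribed about $P$ are concentric.
   Context: The affine plane $\mathbb{R}^2$ is regarded as the chart $\{z\ne 0\}$ of the real projective plane $\mathbb{P}^2=\mathbb{P}(\mathbb{R}^3)$ with homogeneous coordinates $(x,y,z)$; the line at infinity is $\{z=0\}$. A polygon ($n$-gon) is a cyclic sequence of points (vertices) $p_i$, $i\in\mathbb{Z}/n$, in $\mathbb{P}^2$; its sides are the lines $p_ip_{i+1}$. A polygon is convex (in the affine plane) if all its vertices lie in the affine plane and for each $i$ all vertices other than $p_i,p_{i+1}$ lie strictly on one side of the line $p_ip_{i+1}$. Inverse pentagram map: $S(P)$ is the polygon whose vertices are the intersection points of second nearest sides of $P$; i.e. with $\ell_i=p_ip_{i+1}$, the vertices of $S(P)$ are, in cyclic order, $\ell_{i-1}\cap\ell_{i+1}$ (points of $\mathbb{P}^2$; they may be at infinity). For a convex polygon $P$ with at least five vertices all iterates $S^k(P)$ are well-defined polygons in $\mathbb{P}^2$. For a convex $n$-gon $P$ in the affine plane, $d_i$ denotes the vector from vertex $p_{i-1}$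 to vertex $p_{i+1}$, and $\mathcal A_i>0$ denotes the area of the triangle with vertices $p_{i-1},p_i,p_{i+1}$. Glick's operator: let $v_i\in\mathbb{R}^3$ be a vector of homogeneous coordinates of the $i$-th vertex of $P$. Then $$G_P(v) := n v - \sum_{i=1}^n \frac{v_{i-1}\wedge v \wedge v_{i+1}}{v_{i-1}\wedge v_i \wedge v_{i+1}}\,v_i ,$$ where the ratio of elements of the one-dimensional space $\Lambda^3\mathbb{R}^3$ is a number (a ratio of $3\times 3$ determinants); this does not depend on the rescaling of the $v_i$. A linear operator on $\mathbb{R}^3$ regarded as a projective mapping is called affine if it preserves the line at infinity, in the sense that the preimage of the line at infinity is the line at infinity, i.e. the $z$-coordinate of the image of $(x,y,z)$ equals $cz$ for a constant $c\neq0$. The conic circumscribed about a pentagon $P$ is the unique conic in $\mathbb{P}^2$ through its five vertices; the conic inscribed in $P$ is the unique conic tangent to its five side lines. The center of a (nondegenerate) conic is the point of $\mathbb{P}^2$ polar to the line at infinity with respect to that conic; two conics are concentric if their centers coincide. *)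

(* Defs.v *)
From HB Require Import structures.
From mathcomp Require Import all_boot all_order all_algebra.
From mathcomp Require Import reals.

Set Implicit Arguments.
Unset Strict Implicit.
Unset Printing Implicit Defensive.

Import Order.TTheory GRing.Theory Num.Theory.
Local Open Scope ring_scope.

(* Points and lines of the projective plane P(R^3) are the subspaces of
   'rV[R]_3 of dimension 1 and 2.  The join of two points is then the sum
   (_ + _)%VS and the meet of two lines is (_ :&: _)%VS.  Polygons are indexed
   by 'I_n, with the cyclic successor ordS and predecessor ord_pred. *)

Section Polygons.
Variables (R : realType) (n : nat).

Definition orient (a b c : 'rV[R]_2) : R :=
  \det (col_mx (b - a) (c - a) : 'M_2).

Definition triangle_area (a b c : 'rV[R]_2) : R := `|orient a b c| / 2.

Definition convex (P : 'I_n -> 'rV[R]_2) : Prop :=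
  forall i,
    (forall j, j != i -> j != ordS i -> 0 < orient (P i) (P (ordS i)) (P j)) \/
    (forall j, j != i -> j != ordS i -> orient (P i) (P (ordS i)) (P j) < 0).

(* Homogeneous coordinates (x, y, 1) of the affine point (x, y). *)
Definition homog (p : 'rV[R]_2) : 'rV[R]_3 := row_mx p (1%:M : 'M_1).

Definition proj_polygon (P : 'I_n -> 'rV[R]_2) : 'I_n -> {vspace 'rV[R]_3} :=
  fun i => <[homog (P i)]>%VS.

Definition convex_in_affine_plane (Q : 'I_n -> {vspace 'rV[R]_3}) : Prop :=
  exists2 P : 'I_n -> 'rV[R]_2, convex P & Q =1 proj_polygon P.

Definition side (Q : 'I_n -> {vspace 'rV[R]_3}) (i : 'I_n) :
    {vspace 'rV[R]_3} :=
  (Q i + Q (ordS i))%VS.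

Definition inverse_pentagram (Q : 'I_n -> {vspace 'rV[R]_3}) :
    'I_n -> {vspace 'rV[R]_3} :=
  fun i => (side Q (ord_pred i) :&: side Q (ordS i))%VS.

Definition short_diagonal (P : 'I_n -> 'rV[R]_2) (i : 'I_n) : 'rV[R]_2 :=
  P (ordS i) - P (ord_pred i).

Definition vertex_area (P : 'I_n -> 'rV[R]_2) (i : 'I_n) : R :=
  triangle_area (P (ord_pred i)) (P i) (P (ordS i)).

Definition diagonal_sum (P : 'I_n -> 'rV[R]_2) : 'rV[R]_2 :=
  \sum_(i < n) (vertex_area P i)^-1 *: short_diagonal P i.

(* The coordinate of u /\ v /\ w on the standard generator of the third
   exterior power of R^3. *)
Definition wedge3 (u v w : 'rV[R]_3) : R :=
  \det (col_mx u (col_mx v w) : 'M_3).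

(* glick v depends only on the points <[v i]>, not on the representatives. *)
Definition glick (v : 'I_n -> 'rV[R]_3) (u : 'rV[R]_3) : 'rV[R]_3 :=
  n%:R *: u -
  \sum_(i < n) (wedge3 (v (ord_pred i)) u (v (ordS i)) /
                wedge3 (v (ord_pred i)) (v i) (v (ordS i))) *: v i.

End Polygons.

Section Conics.
Variable R : realType.

(* The line {w | w *m u = 0}, for u a nonzero covector. *)
Definition line_of (u : 'cV[R]_3) : {vspace 'rV[R]_3} :=
  lker (linfun (mulmxr u : 'rV[R]_3 -> 'M[R]_1)).

Definition line_at_infinity : {vspace 'rV[R]_3} :=
  line_of (delta_mx ord_max 0).

Definition affine_operator (G : 'rV[R]_3 -> 'rV[R]_3) : Prop :=
  exists2 c : R, c != 0 & forall v, G v 0 ord_max = c * v 0 ord_max.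

(* A conic is the class, up to a nonzero scalar, of a nonzero symmetric
   matrix C; its equation is v *m C *m v^T = 0. *)
Definition is_conic (C : 'M[R]_3) : Prop := C^T = C /\ C != 0.

Definition on_conic (C : 'M[R]_3) (v : 'rV[R]_3) : Prop :=
  v *m C *m v^T = 0.

(* The polar line of <[v]>; it is the whole space if C *m v^T = 0. *)
Definition polar (C : 'M[R]_3) (v : 'rV[R]_3) : {vspace 'rV[R]_3} :=
  line_of (C *m v^T).

(* The tangent line at a smooth point of a conic is the polar of that point.
   At a singular point the polar is the whole space, so the lines through a
   singular point do not count as tangent because of it. *)
Definition tangent (C : 'M[R]_3) (L : {vspace 'rV[R]_3}) : Prop :=
  exists v : 'rV[R]_3, [/\ v != 0, on_conic C v & L = polar C v].

Definition circumscribed n (P : 'I_n -> 'rV[R]_2) (C : 'M[R]_3) : Prop :=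
  forall i, on_conic C (homog (P i)).

Definition inscribed n (P : 'I_n -> 'rV[R]_2) (C : 'M[R]_3) : Prop :=
  forall i, tangent C (side (proj_polygon P) i).

Definition unique_conic (prop : 'M[R]_3 -> Prop) (C : 'M[R]_3) : Prop :=
  [/\ is_conic C, prop C &
      forall C', is_conic C' -> prop C' ->
        exists2 c : R, c != 0 & C' = c *: C].

Definition is_center (C : 'M[R]_3) (v : 'rV[R]_3) : Prop :=
  [/\ C \in unitmx, v != 0 & polar C v = line_at_infinity].

(* Centers are unique as projective points, so sharing a representative
   vector means that they coincide. *)
Definition concentric (C D : 'M[R]_3) : Prop :=
  exists2 v : 'rV[R]_3, is_center C v & is_center D v.

End Conics.

(* Main.v *)
Require Import Defs.
From HB Require Import structures.
From mathcomp Require Import all_boot all_order all_algebra.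
From mathcomp Require Import reals.
From mathcomp Require Import ring lra.

(* Rescaling homogeneous coordinates brings the vertices of a convex pentagon
   to (1,0,0), (a,1,-1), (0,1,0), (-1,1,b), (0,0,1), so that the remaining datum
   is the covector lambda of the line at infinity, which is positive on these
   vectors. There is an explicit nonnegative matrix W such that the inverse
   pentagram map acts on this pentagon as W^-1, up to the relabelling
   i |-> i + 3, and each condition says that lambda is an eigenvector of W.
   - Glick's operator is W + 3, and its third coordinate on directions at
     infinity is, up to a nonzero factor, the area form evaluated against d_P.
   - The pentagon is self-polar for a form Q; the circumscribed and inscribed
     conics are (W - 1) Q and (W - 1)^-1 Q, so they are concentric if and only
     if lambda is an eigenvector of (W - 1)^2. As W^3 = W^2 + kappa W + kappa,
     this forces lambda to be an eigenvector of W.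
   - The iterates are convex and affine if and only if all covectors W^-k lambda
     are positive on the vertices. Their values z_k on a fixed vertex then
     satisfy z_k = z_(k+1) + kappa z_(k+2) + kappa z_(k+3), and a positive
     sequence with this property is geometric. *)

Set Implicit Arguments.
Unset Strict Implicit.
Unset Printing Implicit Defensive.

Import Order.TTheory GRing.Theory Num.Theory.
Local Open Scope ring_scope.

(** * Coordinates in dimension three *)

Section Coordinates.
Variable R : realType.
Implicit Types (u v w : 'rV[R]_3) (X : 'M[R]_3).

Definition ix1 : 'I_3 := @Ordinal 3 1 isT.

Definition vec3 (x y z : R) : 'rV[R]_3 := \row_(j < 3) [:: x; y; z]`_j.

Definition mx3 u v w : 'M[R]_3 := col_mx u (col_mx v w).

Lemma sum_ord3 (V : zmodType) (F : 'I_3 -> V) :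
  \sum_(i < 3) F i = F ord0 + F ix1 + F ord_max.
Proof.
rewrite !big_ord_recl big_ord0 addr0 addrA.
by congr (_ + F _ + F _); apply/val_inj.
Qed.

Lemma ord3_ind (T : 'I_3 -> Prop) :
  T ord0 -> T ix1 -> T ord_max -> forall i, T i.
Proof.
move=> T0 T1 T2 [[|[|[|//]]] lt_i3].
- by rewrite (_ : Ordinal _ = ord0) //; apply/val_inj.
- by rewrite (_ : Ordinal _ = ix1) //; apply/val_inj.
- by rewrite (_ : Ordinal _ = ord_max) //; apply/val_inj.
Qed.

Lemma vec3_0 x y z : vec3 x y z 0 ord0 = x. Proof. by rewrite mxE. Qed.
Lemma vec3_1 x y z : vec3 x y z 0 ix1 = y. Proof. by rewrite mxE. Qed.
Lemma vec3_2 x y z : vec3 x y z 0 ord_max = z. Proof. by rewrite mxE. Qed.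
Definition vec3E := (vec3_0, vec3_1, vec3_2).

Lemma row3P u v :
  u 0 ord0 = v 0 ord0 -> u 0 ix1 = v 0 ix1 -> u 0 ord_max = v 0 ord_max ->
  u = v.
Proof. by move=> e0 e1 e2; apply/rowP; apply: ord3_ind. Qed.

Lemma vec3_eta u : u = vec3 (u 0 ord0) (u 0 ix1) (u 0 ord_max).
Proof. by apply: row3P; rewrite vec3E. Qed.

Lemma vec3D x y z x' y' z' :
  vec3 x y z + vec3 x' y' z' = vec3 (x + x') (y + y') (z + z').
Proof. by apply: row3P; rewrite mxE !vec3E. Qed.

Lemma vec3Z c x y z : c *: vec3 x y z = vec3 (c * x) (c * y) (c * z).
Proof. by apply: row3P; rewrite mxE !vec3E. Qed.
Definition vec3_lin := (vec3Z, vec3D).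

Lemma vec3_eq x y z x' y' z' :
  x = x' -> y = y' -> z = z' -> vec3 x y z = vec3 x' y' z'.
Proof. by move=> -> -> ->. Qed.

Lemma mx3_0 u v w j : mx3 u v w ord0 j = u 0 j.
Proof. by rewrite mxE; case: splitP => // k _; rewrite ord1. Qed.

Lemma mx3_1 u v w j : mx3 u v w ix1 j = v 0 j.
Proof.
rewrite mxE; case: splitP => [k|k []]; first by rewrite ord1.
rewrite mxE; case: splitP => [i _ _|i -> //]; by rewrite ord1.
Qed.

Lemma mx3_2 u v w j : mx3 u v w ord_max j = w 0 j.
Proof.
rewrite mxE; case: splitP => [k|k []]; first by rewrite ord1.
rewrite mxE; case: splitP => [i ->|i _ _]; by rewrite ord1.
Qed.
Definition mx3E := (mx3_0, mx3_1, mx3_2).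

Lemma mul_vec3 x y z u v w :
  vec3 x y z *m mx3 u v w = x *: u + y *: v + z *: w.
Proof. by apply/rowP=> j; rewrite mxE sum_ord3 !vec3E !mx3E !mxE. Qed.

Lemma mul_mx3 u v w X : mx3 u v w *m X = mx3 (u *m X) (v *m X) (w *m X).
Proof.
by apply/matrixP=> i j; move: i; apply: ord3_ind;
  rewrite mxE sum_ord3 !mx3E mxE sum_ord3.
Qed.

Lemma lift3E :
  (lift (ord0 : 'I_3) (ord0 : 'I_2) = ix1) *
  (lift (ord0 : 'I_3) (ord_max : 'I_2) = ord_max) *
  (lift ix1 (ord0 : 'I_2) = ord0) * (lift ix1 (ord_max : 'I_2) = ord_max) *
  (lift (ord_max : 'I_3) (ord0 : 'I_2) = ord0) *
  (lift (ord_max : 'I_3) (ord_max : 'I_2) = ix1).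
Proof. by do !split; apply/val_inj. Qed.

Lemma det2 (X : 'M[R]_2) :
  \det X = X ord0 ord0 * X ord_max ord_max - X ord0 ord_max * X ord_max ord0.
Proof.
rewrite (expand_det_row _ ord0) !big_ord_recl big_ord0 /cofactor !det_mx11 !mxE.
have l00 : lift (ord0 : 'I_2) 0 = ord_max by apply/val_inj.
have l10 : lift (ord_max : 'I_2) 0 = ord0 by apply/val_inj.
have -> : lift (ord0 : 'I_2) ord0 = ord_max by apply/val_inj.
by rewrite ?l00 ?l10 /=; ring.
Qed.

Lemma det3 X : \det X =
  X ord0 ord0 * (X ix1 ix1 * X ord_max ord_max - X ix1 ord_max * X ord_max ix1)
  - X ord0 ix1 *
      (X ix1 ord0 * X ord_max ord_max - X ix1 ord_max * X ord_max ord0)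
  + X ord0 ord_max *
      (X ix1 ord0 * X ord_max ix1 - X ix1 ix1 * X ord_max ord0).
Proof.
rewrite (expand_det_row _ ord0) sum_ord3 /cofactor.
rewrite !det2 !mxE /=.
rewrite !lift3E /=.
ring.
Qed.

Lemma wedge3E u v w : wedge3 u v w =
  u 0 ord0 * (v 0 ix1 * w 0 ord_max - v 0 ord_max * w 0 ix1)
  - u 0 ix1 * (v 0 ord0 * w 0 ord_max - v 0 ord_max * w 0 ord0)
  + u 0 ord_max * (v 0 ord0 * w 0 ix1 - v 0 ix1 * w 0 ord0).
Proof. by rewrite /wedge3 -/(mx3 u v w) det3 !mx3E. Qed.

Lemma wedge3_mulmx u v w X :
  wedge3 (u *m X) (v *m X) (w *m X) = wedge3 u v w * \det X.
Proof. by rewrite /wedge3 -!/(mx3 _ _ _) -mul_mx3 det_mulmx. Qed.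

Lemma wedge3_scale a b c u v w :
  wedge3 (a *: u) (b *: v) (c *: w) = a * b * c * wedge3 u v w.
Proof. by rewrite !wedge3E !mxE; ring. Qed.

Lemma wedge3_rot u v w : wedge3 u v w = wedge3 v w u.
Proof. by rewrite !wedge3E; ring. Qed.

(** Cramer's rule with denominators cleared, hence a polynomial identity. *)
Lemma cramer3 p q r u :
  wedge3 p q r *: u =
  wedge3 u q r *: p + wedge3 p u r *: q + wedge3 p q u *: r.
Proof. by apply: row3P; rewrite !wedge3E !mxE; ring. Qed.

Lemma homog0 (p : 'rV[R]_2) : homog p 0 ord0 = p 0 ord0.
Proof.
by rewrite mxE; case: splitP => [k /= k0|//]; congr (p 0 _); apply/val_inj.
Qed.

Lemma homog1 (p : 'rV[R]_2) : homog p 0 ix1 = p 0 ord_max.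
Proof.
by rewrite mxE; case: splitP => [k /= k1|//]; congr (p 0 _); apply/val_inj.
Qed.

Lemma homog2 (p : 'rV[R]_2) : homog p 0 ord_max = 1.
Proof.
rewrite mxE; case: splitP => [k /= k2|k _]; last by rewrite ord1 mxE.
by have := ltn_ord k; rewrite -k2.
Qed.
Definition homogE := (homog0, homog1, homog2).

Lemma orientE (a b c : 'rV[R]_2) :
  orient a b c = wedge3 (homog a) (homog b) (homog c).
Proof.
rewrite wedge3E !homogE /orient det2.
have top j : col_mx (b - a) (c - a) (ord0 : 'I_2) j = (b - a) 0 j.
  by rewrite mxE; case: splitP => // k _; rewrite ord1.
have bot j : col_mx (b - a) (c - a) (ord_max : 'I_2) j = (c - a) 0 j.
  by rewrite mxE; case: splitP => [k|k _]; rewrite ord1.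
rewrite !top !bot !mxE.
ring.
Qed.

Lemma affine_point (v : 'rV[R]_3) : v 0 ord_max = 1 ->
  exists p : 'rV[R]_2, homog p = v.
Proof.
move=> v2; exists (\row_(j < 2) [:: v 0 ord0; v 0 ix1]`_j).
by apply: row3P; rewrite homogE ?mxE.
Qed.

End Coordinates.

(** * Points and lines as subspaces *)

Section Incidence.
Variable R : realType.
Implicit Types (p q r u v w : 'rV[R]_3) (x y : 'cV[R]_3).

Lemma mem_line_of y u : (u \in line_of y) = (u *m y == 0).
Proof. by rewrite memv_ker lfunE. Qed.

Lemma mul_row_eq0 y : (forall u, u *m y = 0) -> y = 0.
Proof.
move=> y0; rewrite -[y]mul1mx; apply/row_matrixP=> i.
by rewrite row_mul y0 row0.
Qed.

Lemma covector_colinear x y :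
  x != 0 -> (forall u, u *m x = 0 -> u *m y = 0) -> exists t, y = t *: x.
Proof.
move=> x0 xy.
have [i xi0] : exists i, x i 0 != 0.
  apply/existsP; apply: contra_neqT x0 => /existsPn x0.
  apply/matrixP=> i j; rewrite ord1 mxE; apply/eqP.
  by have := x0 i; rewrite negbK.
exists (y i 0 / x i 0); apply/matrixP=> j k; rewrite ord1 mxE.
(* These combinations of basis vectors lie in the kernel of [x], and their vanishing on [y]
   determines [y] from its [i]-th entry. *)
have /xy : (x i 0 *: delta_mx 0 j - x j 0 *: delta_mx 0 i : 'rV_3) *m x = 0.
  rewrite mulmxBl -!scalemxAl -!rowE; apply/matrixP=> a b.
  by rewrite !ord1 !mxE mulrC subrr.
rewrite mulmxBl -!scalemxAl -!rowE => /matrixP/(_ 0 0).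
rewrite !mxE => /subr0_eq e.
by apply: (mulfI xi0); rewrite e; field.
Qed.

Lemma line_of_inj x y : x != 0 -> line_of x = line_of y ->
  exists t, y = t *: x.
Proof.
move=> x0 xy; apply: covector_colinear => // u ux.
by apply/eqP; rewrite -mem_line_of -xy mem_line_of ux.
Qed.

Lemma line_ofZ t y : t != 0 -> line_of (t *: y) = line_of y.
Proof.
move=> t0; apply/vspaceP=> u.
by rewrite !mem_line_of -scalemxAr scaler_eq0 (negPf t0).
Qed.

Lemma mem_join p q u :
  reflect (exists a b, u = a *: p + b *: q) (u \in <[p]> + <[q]>)%VS.
Proof.
apply: (iffP memv_addP) => [[_ /vlineP[a ->] [_ /vlineP[b ->] ->]]|[a [b ->]]].
  by exists a, b.
by exists (a *: p); [|exists (b *: q)]; rewrite ?memvZ ?memv_line.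
Qed.

Lemma wedge3_join p q r u : wedge3 p q r != 0 ->
  (u \in <[p]> + <[q]>)%VS = (wedge3 p q u == 0).
Proof.
move=> pqr; apply/mem_join/eqP => [[a [b ->]]|pqu].
  by rewrite wedge3E !mxE; ring.
exists (wedge3 u q r / wedge3 p q r), (wedge3 p u r / wedge3 p q r).
apply: (scalerI pqr); rewrite cramer3 pqu scale0r addr0.
by rewrite scalerDr !scalerA; congr (_ *: _ + _ *: _); field.
Qed.

(** Modulo [p] and [q] every vector is a multiple of [r], so as a linear form [y] is proportional to
    [wedge3 p q]. *)
Lemma line_of_join p q r y : wedge3 p q r != 0 -> y != 0 ->
  p *m y = 0 -> q *m y = 0 -> line_of y = (<[p]> + <[q]>)%VS.
Proof.
move=> pqr y0 py qy; apply/vspaceP=> u.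
rewrite mem_line_of (wedge3_join _ pqr).
have cr v : wedge3 p q r *: (v *m y) = wedge3 p q v *: (r *m y).
  by rewrite scalemxAl cramer3 !mulmxDl -!scalemxAl py qy !scaler0 !add0r.
have ry : r *m y != 0.
  apply: contra_neq y0 => ry; apply: mul_row_eq0 => v.
  by apply: (scalerI pqr); rewrite cr ry !scaler0.
apply/eqP/eqP => [uy|pqu].
  have /eqP := cr u; rewrite uy scaler0 eq_sym scaler_eq0 (negPf ry) orbF.
  by move/eqP.
by apply: (scalerI pqr); rewrite cr pqu scale0r scaler0.
Qed.

(** As [d != 0], the vector [u] can be eliminated in favour of [w] and [r]. Since [r] is off the
    line [pq] while [w] is on it, a combination of the two that lies on [pq] has no [r]
    component. *)
Lemma meet_joins p q r u w a b c d :
  wedge3 p q r != 0 -> d != 0 ->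
  w = a *: p + b *: q -> w = c *: r + d *: u ->
  ((<[p]> + <[q]>) :&: (<[r]> + <[u]>))%VS = <[w]>%VS.
Proof.
move=> pqr d0 wpq wru; apply/vspaceP=> v; rewrite memv_cap.
apply/andP/vlineP => [[]|[t ->]]; last first.
  split; apply: memvZ; apply/mem_join; [by exists a, b|by exists c, d].
rewrite (wedge3_join _ pqr) => pqv /mem_join[e [f vE]].
exists (f / d).
have pqw : wedge3 p q w = 0 by rewrite wpq wedge3E !mxE; ring.
have key : (d * e - f * c) * wedge3 p q r = 0.
  transitivity (d * wedge3 p q v - f * wedge3 p q w).
    by rewrite vE wru !wedge3E !mxE; ring.
  by rewrite (eqP pqv) pqw !mulr0 subrr.
have {key} e_eq : e = f * c / d.
  move/eqP: key; rewrite mulf_eq0 (negPf pqr) orbF subr_eq0 => /eqP key.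
  by rewrite -key; field.
rewrite vE wru e_eq scalerDr !scalerA.
by congr (_ *: _ + _ *: _); field.
Qed.

Lemma vline_eq u v : v != 0 -> <[v]>%VS = <[u]>%VS ->
  exists2 t, t != 0 & v = t *: u.
Proof.
move=> v0 uv; have /vlineP[t vE] : v \in <[u]>%VS by rewrite -uv memv_line.
by exists t => //; apply: contra_neq v0 => t0; rewrite vE t0 scale0r.
Qed.

Lemma vlineZ t u : t != 0 -> <[t *: u]>%VS = <[u]>%VS.
Proof.
move=> t0; apply/vspaceP=> v; apply/vlineP/vlineP => -[k ->].
  by exists (k * t); rewrite scalerA.
by exists (k / t); rewrite scalerA divfK.
Qed.

End Incidence.

(** * The normal form of a pentagon *)

Definition k0 : 'I_5 := @Ordinal 5 0 isT.
Definition k1 : 'I_5 := @Ordinal 5 1 isT.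
Definition k2 : 'I_5 := @Ordinal 5 2 isT.
Definition k3 : 'I_5 := @Ordinal 5 3 isT.
Definition k4 : 'I_5 := @Ordinal 5 4 isT.

Lemma ord5_ind (T : 'I_5 -> Prop) :
  T k0 -> T k1 -> T k2 -> T k3 -> T k4 -> forall i, T i.
Proof.
move=> T0 T1 T2 T3 T4 [[|[|[|[|[|//]]]]] lt_i5].
- by rewrite (_ : Ordinal _ = k0) //; apply/val_inj.
- by rewrite (_ : Ordinal _ = k1) //; apply/val_inj.
- by rewrite (_ : Ordinal _ = k2) //; apply/val_inj.
- by rewrite (_ : Ordinal _ = k3) //; apply/val_inj.
- by rewrite (_ : Ordinal _ = k4) //; apply/val_inj.
Qed.

Lemma sum_ord5 (V : zmodType) (F : 'I_5 -> V) :
  \sum_(i < 5) F i = F k0 + F k1 + F k2 + F k3 + F k4.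
Proof.
rewrite !big_ord_recl big_ord0 addr0 !addrA.
by congr (_ + _ + _ + _ + _); congr F; apply/val_inj.
Qed.

Lemma ordS5 :
  (ordS k0 = k1) * (ordS k1 = k2) * (ordS k2 = k3) * (ordS k3 = k4) *
  (ordS k4 = k0).
Proof. by do !split; apply/val_inj. Qed.

Lemma ord_pred5 :
  (ord_pred k0 = k4) * (ord_pred k1 = k0) * (ord_pred k2 = k1) *
  (ord_pred k3 = k2) * (ord_pred k4 = k3).
Proof. by do !split; apply/val_inj. Qed.

Definition ord5E := (ordS5, ord_pred5).

Definition shift3 n (i : 'I_n) : 'I_n := ordS (ordS (ordS i)).

Lemma iter_shift3_ordS n k (i : 'I_n) :
  iter k (@shift3 n) (ordS i) = ordS (iter k (@shift3 n) i).
Proof. by elim: k => //= k ->. Qed.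

Lemma iter_shift3_pred n k (i : 'I_n) :
  iter k (@shift3 n) (ord_pred i) = ord_pred (iter k (@shift3 n) i).
Proof. by rewrite -{2}[i]ord_predK iter_shift3_ordS ordSK. Qed.

Lemma iter_shift3_inj n k : injective (iter k (@shift3 n)).
Proof.
elim: k => [|k IHk] i j //=.
by move/(can_inj (@ordSK _))/(can_inj (@ordSK _))/(can_inj (@ordSK _))/IHk.
Qed.

Lemma iter_shift3_surj k (j : 'I_5) : exists i, iter k (@shift3 5) i = j.
Proof.
elim: k j => [|k IHk] j; first by exists j.
(* Two further successors complete a shift by 3 to a full turn. *)
have [i <-] := IHk j; exists (ordS (ordS i)); rewrite iterSr; congr iter.
by move: i {IHk}; apply: ord5_ind; rewrite /shift3 !ordS5.
Qed.

Section NormalForm.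
Variables (R : realType) (a b : R).
Hypotheses (a_gt0 : 0 < a) (b_gt0 : 0 < b) (ab_gt1 : 1 < a * b).
Implicit Types (u : 'rV[R]_3).

Definition std (i : 'I_5) : 'rV[R]_3 :=
  nth 0 [:: vec3 1 0 0; vec3 a 1 (-1); vec3 0 1 0; vec3 (-1) 1 b; vec3 0 0 1] i.

(* [star_tip]: the vertices of the inverse pentagram image of [std] are the
   [std (i + 3) *m starW^-1]. *)
Definition starW : 'M[R]_3 :=
  mx3 (vec3 0 (b * (a + 1) / (a * b - 1)) b)
      (vec3 a 1 b)
      (vec3 a (a * (b + 1) / (a * b - 1)) 0).

(** The determinant of [starW], and up to sign the sum of its principal 2 x 2 minors. *)
Definition kappa : R := a * b * (a + 1) * (b + 1) / (a * b - 1).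

(* The symmetric form for which [std i] is orthogonal to [std (i + 2)], hence
   for which each side is the polar line of the opposite vertex. *)
Definition polarity : 'M[R]_3 :=
  mx3 (vec3 b 0 1) (vec3 0 (a * b - 1) 0) (vec3 1 0 a).

(** The conic through the five [std] vertices; its zero diagonal says that it contains the three
    coordinate points. *)
Definition circ : 'M[R]_3 :=
  mx3 (vec3 0 (b * (a + 1)) (a * b - 1))
      (vec3 (b * (a + 1)) 0 (a * (b + 1)))
      (vec3 (a * b - 1) (a * (b + 1)) 0).

Lemma std0 : std k0 = vec3 1 0 0. Proof. by []. Qed.
Lemma std1 : std k1 = vec3 a 1 (-1). Proof. by []. Qed.
Lemma std2 : std k2 = vec3 0 1 0. Proof. by []. Qed.
Lemma std3 : std k3 = vec3 (-1) 1 b. Proof. by []. Qed.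
Lemma std4 : std k4 = vec3 0 0 1. Proof. by []. Qed.
Definition stdE := (std0, std1, std2, std3, std4).

Let a_neq0 : a != 0. Proof. exact: lt0r_neq0. Qed.
Let b_neq0 : b != 0. Proof. exact: lt0r_neq0. Qed.
Let a1_gt0 : 0 < a + 1. Proof. exact: addr_gt0. Qed.
Let b1_gt0 : 0 < b + 1. Proof. exact: addr_gt0. Qed.
Let a1_neq0 : a + 1 != 0. Proof. exact: lt0r_neq0. Qed.
Let b1_neq0 : b + 1 != 0. Proof. exact: lt0r_neq0. Qed.
Let r_gt0 : 0 < a * b - 1. Proof. by rewrite subr_gt0. Qed.
Let r_neq0 : a * b - 1 != 0. Proof. exact: lt0r_neq0. Qed.

Lemma kappa_gt0 : 0 < kappa.
Proof. by rewrite /kappa !mulr_gt0 ?invr_gt0. Qed.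

Lemma std_ext (m : nat) (X Y : 'M[R]_(3, m)) :
  std k0 *m X = std k0 *m Y -> std k2 *m X = std k2 *m Y ->
  std k4 *m X = std k4 *m Y -> X = Y.
Proof.
move=> e0 e2 e4; apply/row_matrixP; apply: ord3_ind; rewrite !rowE.
- by rewrite (_ : delta_mx 0 ord0 = std k0) //; apply: row3P;
    rewrite stdE vec3E mxE.
- by rewrite (_ : delta_mx 0 ix1 = std k2) //; apply: row3P;
    rewrite stdE vec3E mxE.
- by rewrite (_ : delta_mx 0 ord_max = std k4) //; apply: row3P;
    rewrite stdE vec3E mxE.
Qed.

Lemma mul_starW x y z :
  vec3 x y z *m starW =
  vec3 (a * (y + z))
       (b * (a + 1) / (a * b - 1) * x + y + a * (b + 1) / (a * b - 1) * z)
       (b * (x + y)).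
Proof. by rewrite mul_vec3 !vec3_lin; apply: vec3_eq; ring. Qed.

(** Cayley-Hamilton for [starW], whose trace is 1. *)
Lemma starW_char :
  starW *m starW *m starW = starW *m starW + kappa *: starW + kappa%:M.
Proof.
apply: std_ext; rewrite !mulmxDr -!scalemxAr !mul_mx_scalar !mulmxA !stdE;
  rewrite !mul_starW !vec3_lin; apply: vec3_eq; rewrite /kappa;
  by field; exact: r_neq0.
Qed.

Lemma starW_char_mul (l : 'cV[R]_3) :
  starW *m (starW *m (starW *m l)) =
  starW *m (starW *m l) + kappa *: (starW *m l) + kappa *: l.
Proof. by rewrite !mulmxA starW_char !mulmxDl -scalemxAl mul_scalar_mx. Qed.

(** Both coefficients are positive, so if [l] is positive on the vertices then [starW *m l] is
    positive at [std k0]. Signs of eigenvalues and of covectors are decided by this. *)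
Lemma std0_starW : std k0 *m starW =
  (b * (a + 1) / (a * b - 1)) *: std k2 + b *: std k4.
Proof. by rewrite !stdE mul_starW !vec3_lin; apply: vec3_eq; ring. Qed.

Lemma starW_unit : starW \in unitmx.
Proof.
rewrite unitmxE unitfE det3 !mx3E !vec3E; apply: lt0r_neq0.
rewrite [ltRHS](_ : _ = kappa) ?kappa_gt0 //.
by rewrite /kappa; field.
Qed.

Lemma polarity_sym : polarity^T = polarity.
Proof.
by apply/matrixP=> i j; move: i j; do 2!apply: ord3_ind;
  rewrite mxE !mx3E !vec3E.
Qed.

Lemma circ_sym : circ^T = circ.
Proof.
by apply/matrixP=> i j; move: i j; do 2!apply: ord3_ind;
  rewrite mxE !mx3E !vec3E.
Qed.

(** As [circ] and [polarity] are symmetric, this also makes [starW - 1%:M] self-adjoint for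
    [polarity]. *)
Lemma starW_polarity : (starW - 1%:M) *m polarity = circ.
Proof.
apply: std_ext; rewrite !stdE mulmxA mulmxBr mulmx1 mul_starW -scaleN1r
  !vec3_lin !mul_vec3 !vec3_lin; apply: vec3_eq; by field; exact: r_neq0.
Qed.

Lemma polarity_unit : polarity \in unitmx.
Proof.
rewrite unitmxE unitfE det3 !mx3E !vec3E.
rewrite (_ : _ + _ = (a * b - 1) ^+ 2) ?expf_neq0 //.
by ring.
Qed.

Lemma starW1_unit : starW - 1%:M \in unitmx.
Proof.
have : circ \in unitmx.
  rewrite unitmxE unitfE det3 !mx3E !vec3E; apply: lt0r_neq0.
  rewrite [ltRHS](_ : _ = 2 * (a * (b * ((a + 1) * ((b + 1) * (a * b - 1)))))).
    by rewrite !mulr_gt0.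
  by ring.
by rewrite -starW_polarity unitmx_mul => /andP[].
Qed.

(** The combination lies on the side through vertices i - 1, i and on the side through i + 1, i + 2,
    so it represents the i-th vertex of the inverse pentagram image. The coefficients are scaled so
    that [starW] sends it exactly to a [std] vertex; [q != 0] is the nondegeneracy required by
    [meet_joins]. *)
Lemma star_tip i : exists s t p q,
  [/\ q != 0,
      s *: std (ord_pred i) + t *: std i =
        p *: std (ordS i) + q *: std (ordS (ordS i)) &
      (s *: std (ord_pred i) + t *: std i) *m starW =
        std (ordS (ordS (ordS i)))].
Proof.
have nz x : x != 0 -> - x^-1 != 0 by rewrite oppr_eq0 invr_eq0.
have solve s t p q x y z x' y' z' x1 y1 z1 x2 y2 z2 x3 y3 z3 :
    q != 0 ->
    vec3 (s * x + t * x') (s * y + t * y') (s * z + t * z') =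
    vec3 (p * x1 + q * x2) (p * y1 + q * y2) (p * z1 + q * z2) ->
    vec3 (s * x + t * x') (s * y + t * y') (s * z + t * z') *m starW =
      vec3 x3 y3 z3 ->
    [/\ q != 0,
        s *: vec3 x y z + t *: vec3 x' y' z' =
          p *: vec3 x1 y1 z1 + q *: vec3 x2 y2 z2 &
        (s *: vec3 x y z + t *: vec3 x' y' z') *m starW = vec3 x3 y3 z3].
  by move=> *; split; rewrite ?vec3_lin.
move: i; apply: ord5_ind; rewrite !ord5E !stdE.
- exists (- a^-1), 1, a^-1, (- a^-1).
  apply: solve; first exact: nz; rewrite ?mul_starW; apply: vec3_eq; field;
    by rewrite ?a_neq0 ?r_neq0.
- exists (- (a * b - 1) / (b * (b + 1))), (b / (b * (b + 1))).
  exists ((b + 1) / (b * (b + 1))), (- (b * (b + 1))^-1).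
  apply: solve; first by rewrite nz ?mulf_neq0.
    by apply: vec3_eq; field; rewrite b_neq0 b1_neq0.
  by rewrite mul_starW; apply: vec3_eq; field; rewrite ?b_neq0 ?b1_neq0 ?r_neq0.
- exists (- (a * (a + 1))^-1), ((a + 1) / (a * (a + 1))).
  exists (a / (a * (a + 1))), (- (a * b - 1) / (a * (a + 1))).
  apply: solve; first by rewrite mulf_neq0 ?oppr_eq0 ?invr_eq0 ?mulf_neq0.
    by apply: vec3_eq; field; rewrite a_neq0 a1_neq0.
  by rewrite mul_starW; apply: vec3_eq; field; rewrite ?a_neq0 ?a1_neq0 ?r_neq0.
- exists (- b^-1), b^-1, 1, (- b^-1).
  apply: solve; first exact: nz; rewrite ?mul_starW; apply: vec3_eq; field;
    by rewrite ?b_neq0 ?r_neq0.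
- pose c := (a * b - 1) / ((a + 1) * (b + 1)).
  have c0 : c != 0 by rewrite mulf_neq0 ?invr_eq0 ?mulf_neq0.
  exists (- c), ((b + 1) * c), ((a + 1) * c), (- c).
  apply: solve; first by rewrite oppr_eq0.
    by apply: vec3_eq; ring.
  by rewrite mul_starW; apply: vec3_eq; rewrite /c; field;
    rewrite ?a1_neq0 ?b1_neq0 ?r_neq0.
Qed.

Lemma std_wedge_gt0 i j : j != i -> j != ordS i ->
  0 < wedge3 (std i) (std (ordS i)) (std j).
Proof.
by move: i j; do 2!apply: ord5_ind; rewrite ?ord5E // => _ _;
  rewrite !stdE wedge3E !vec3E;
  have := a_gt0; have := b_gt0; have := ab_gt1; lra.
Qed.

Lemma std_polarity i : std i *m polarity *m (std (ordS (ordS i)))^T = 0.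
Proof.
apply/matrixP=> j k; rewrite !ord1 {j k} mxE sum_ord3 ![_^T _ _]mxE [RHS]mxE.
by move: i; apply: ord5_ind;
  rewrite !ord5E !stdE mul_vec3 !vec3_lin !vec3E; ring.
Qed.

Lemma glick_std u : glick std u = u *m (starW + 3%:M).
Proof.
rewrite /glick sum_ord5 !ord5E !wedge3E !stdE !vec3E mulmxDr mul_mx_scalar.
rewrite (vec3_eta u); move: (u 0 _) (u 0 _) (u 0 _) => x y z.
rewrite mul_starW !vec3E -scaleN1r !vec3_lin; apply: vec3_eq; field;
  by rewrite ?a_neq0 ?b_neq0 ?r_neq0.
Qed.

End NormalForm.

(** * Changes of coordinates and orientations of a convex pentagon *)

Section Transport.
Variable R : realType.

(** In each ratio the determinants of [M] cancel, and so do the factors [c] except [c i] in the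
    denominator, which compensates the rescaling of [v i]. *)
Lemma glick_mulmx n (v w : 'I_n -> 'rV[R]_3) (c : 'I_n -> R) (M : 'M[R]_3)
    (u : 'rV[R]_3) :
  M \in unitmx -> (forall i, c i != 0) ->
  (forall i, w i = c i *: (v i *m M)) -> glick w (u *m M) = glick v u *m M.
Proof.
move=> Mu c0 wE; rewrite /glick mulmxBl -scalemxAl; congr (_ - _).
rewrite mulmx_suml; apply: eq_bigr => i _.
rewrite !wE -[u *m M]scale1r !wedge3_scale !wedge3_mulmx scalerA -scalemxAl.
congr (_ *: _).
have detM : \det M != 0 by rewrite -unitfE -unitmxE.
(* A degenerate triple contributes zero on both sides, since the inverse of zero is zero. *)
have [->|w0] := eqVneq (wedge3 (v (ord_pred i)) (v i) (v (ordS i))) 0.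
  by rewrite mul0r mulr0 invr0 !mulr0 mul0r.
by field; rewrite w0 detM !c0.
Qed.

(** Positivity of a product is used as the relation of having the same nonzero sign. *)
Lemma mul0lt_trans (x y z : R) : 0 < x * y -> 0 < y * z -> 0 < x * z.
Proof.
move=> xy yz.
have y0 : y != 0 by apply: contraTneq xy => ->; rewrite mulr0 ltxx.
have : 0 < (x * y) * (y * z) by rewrite mulr_gt0.
rewrite (_ : _ * _ = (y * y) * (x * z)); last by ring.
by rewrite pmulr_rgt0 // -expr2 exprn_even_gt0.
Qed.

Lemma convex_mul_gt0 n (P : 'I_n -> 'rV[R]_2) i j k : convex P ->
  j != i -> j != ordS i -> k != i -> k != ordS i ->
  0 < orient (P i) (P (ordS i)) (P j) * orient (P i) (P (ordS i)) (P k).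
Proof.
move=> /(_ i)[] s ji jSi ki kSi; first by rewrite mulr_gt0 ?s.
by rewrite nmulr_rgt0 ?s.
Qed.

Lemma orient_rot (p q r : 'rV[R]_2) : orient p q r = orient q r p.
Proof. by rewrite !orientE wedge3_rot. Qed.

(** Adjacent sides share the triangle of three consecutive vertices, so the sign provided by
    convexity propagates from side to side; and any three vertices of a pentagon include two
    adjacent ones. *)
Lemma pentagon_orient (P : 'I_5 -> 'rV[R]_2) (i j k : 'I_5) : convex P ->
  (i < j < k)%N ->
  0 < orient (P k0) (P k1) (P k2) * orient (P i) (P j) (P k).
Proof.
move=> cP; set o := fun i j k => orient (P i) (P j) (P k).
have rot i' j' k' : o i' j' k' = o j' k' i' by apply: orient_rot.
have cx i' i'' j' k' : i'' = ordS i' -> j' != i' -> j' != i'' ->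
    k' != i' -> k' != i'' -> 0 < o i' i'' j' * o i' i'' k'.
  by move=> ->; apply: convex_mul_gt0.
have e0 k' : k' != k0 -> k' != k1 -> 0 < o k0 k1 k2 * o k0 k1 k'.
  by move=> *; apply: cx; rewrite ?ordS5.
have e1 k' : k' != k1 -> k' != k2 -> 0 < o k0 k1 k2 * o k1 k2 k'.
  by move=> *; rewrite rot; apply: cx; rewrite ?ordS5.
have e2 k' : k' != k2 -> k' != k3 -> 0 < o k0 k1 k2 * o k2 k3 k'.
  move=> *; apply: mul0lt_trans (e1 k3 isT isT) _.
  by rewrite rot; apply: cx; rewrite ?ordS5.
have e3 k' : k' != k3 -> k' != k4 -> 0 < o k0 k1 k2 * o k3 k4 k'.
  move=> *; apply: mul0lt_trans (e2 k4 isT isT) _.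
  by rewrite rot; apply: cx; rewrite ?ordS5.
have e4 k' : k' != k4 -> k' != k0 -> 0 < o k0 k1 k2 * o k4 k0 k'.
  move=> *; apply: mul0lt_trans (e0 k4 isT isT) _.
  by rewrite -rot; apply: cx; rewrite ?ordS5.
suff: (i < j < k)%N -> 0 < o k0 k1 k2 * o i j k by [].
move: i j k; do 3!apply: ord5_ind => //; move=> _.
- exact: e0.
- exact: e0.
- exact: e0.
- by rewrite (rot k0 k2); apply: e2.
- by rewrite -(rot k4); apply: e4.
- by rewrite (rot k0 k3); apply: e3.
- exact: e1.
- exact: e1.
- by rewrite (rot k1 k3); apply: e3.
- exact: e2.
Qed.

(** A common sign [e] removes the absolute values in the areas, whichever way the pentagon is
    traversed. *)
Lemma orient_sign (P : 'I_5 -> 'rV[R]_2) : convex P ->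
  exists2 e : R, e != 0 & forall i,
    orient (P (ord_pred i)) (P i) (P (ordS i)) =
    e * `|orient (P (ord_pred i)) (P i) (P (ordS i))| /\
    orient (P (ord_pred i)) (P i) (P (ordS i)) != 0.
Proof.
move=> cP; set o := orient (P k0) (P k1) (P k2).
have key i : 0 < o * orient (P (ord_pred i)) (P i) (P (ordS i)).
  move: i; apply: ord5_ind; rewrite !ord5E; do ?exact: pentagon_orient.
    by rewrite orient_rot; apply: pentagon_orient.
  by rewrite -orient_rot; apply: pentagon_orient.
have o0 : o != 0 by apply: contraTneq (key k0) => ->; rewrite mul0r ltxx.
exists (Num.sg o) => [|i]; first by rewrite sgr_eq0.
have := key i; set z := orient _ _ _ => oz.
split; last by apply: contraTneq oz => ->; rewrite mulr0 ltxx.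
move: oz; have [o_gt0|o_lt0|oE] := ltgtP 0 o.
- by rewrite pmulr_rgt0 // => z0; rewrite gtr0_sg // mul1r gtr0_norm.
- by rewrite nmulr_rgt0 // => z0; rewrite ltr0_sg // ltr0_norm // mulN1r opprK.
- by rewrite -oE eqxx in o0.
Qed.

(** Vertices 1 and 3 are expanded in the basis of vertices 0, 2, 4, with signs of the coefficients
    dictated by convexity. Rescaling the five vectors then brings four coefficients to 1 or -1. *)
Lemma pentagon_normal_form (P : 'I_5 -> 'rV[R]_2) : convex P ->
  exists a b (M : 'M[R]_3) (c : 'I_5 -> R),
    [/\ [/\ 0 < a, 0 < b & 1 < a * b], M \in unitmx, forall i, 0 < c i &
        forall i, homog (P i) = c i *: (std a b i *m M)].
Proof.
move=> cP; pose p i := homog (P i).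
pose o i j k := wedge3 (p i) (p j) (p k).
(* Division by one orientation makes the sign independent of the sense of traversal. *)
have pos (i j k : 'I_5) : (i < j < k)%N -> 0 < o i j k / o k0 k2 k4.
  move=> lt_ijk; have := pentagon_orient cP (isT : (k0 < k2 < k4)%N).
  rewrite mulrC => /mul0lt_trans/(_ (pentagon_orient cP lt_ijk)).
  rewrite !orientE -!/(o _ _ _) => h.
  have o0 : o k0 k2 k4 != 0 by apply: contraTneq h => ->; rewrite mul0r ltxx.
  rewrite -(@pmulr_rgt0 _ (o k0 k2 k4 ^+ 2)) ?exprn_even_gt0 //.
  by rewrite expr2 mulrA mulrAC mulfK.
have D0 : o k0 k2 k4 != 0.
  by apply: contraTneq (pos k0 k1 k2 isT) => ->; rewrite invr0 mulr0 ltxx.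
pose A0 := o k1 k2 k4 / o k0 k2 k4; pose A2 := o k0 k1 k4 / o k0 k2 k4.
pose A4 := o k0 k1 k2 / o k0 k2 k4; pose B0 := o k2 k3 k4 / o k0 k2 k4.
pose B2 := o k0 k3 k4 / o k0 k2 k4; pose B4 := o k0 k2 k3 / o k0 k2 k4.
have A0p : 0 < A0 by apply: pos.
have A2p : 0 < A2 by apply: pos.
have A4p : 0 < A4 by apply: pos.
have B0p : 0 < B0 by apply: pos.
have B2p : 0 < B2 by apply: pos.
have B4p : 0 < B4 by apply: pos.
have p1E : p k1 = A0 *: p k0 + A2 *: p k2 - A4 *: p k4.
  apply: (scalerI D0); rewrite cramer3 !scalerDr scalerN !scalerA -scaleNr.
  rewrite -/(o _ _ _); congr (_ *: _ + _ *: _ + _ *: _); rewrite /A0 /A2 /A4.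
  - by rewrite /o; field.
  - by rewrite /o; field.
  - by rewrite mulrC divfK // /o !wedge3E; ring.
have p3E : p k3 = - B0 *: p k0 + B2 *: p k2 + B4 *: p k4.
  apply: (scalerI D0); rewrite cramer3 !scalerDr !scalerA.
  rewrite -/(o _ _ _); congr (_ *: _ + _ *: _ + _ *: _); rewrite /B0 /B2 /B4.
  - by rewrite mulrN mulrC divfK // /o !wedge3E; ring.
  - by rewrite /o; field.
  - by rewrite /o; field.
(* The orientation of vertices 1, 2, 3 in this basis; it becomes [1 < a * b]. *)
have ABp : A4 * B0 < A0 * B4.
  rewrite -subr_gt0; have := pos k1 k2 k3 isT.
  suff -> : o k1 k2 k3 = (A0 * B4 - A4 * B0) * o k0 k2 k4 by rewrite mulfK.
  by rewrite /o p1E p3E !wedge3E !mxE; ring.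
clearbody A0 A2 A4 B0 B2 B4.
(* Chosen so that, once [p k1] and [p k3] are divided by [A2] and [B2], their negative coordinates
   with respect to the rows of [M] are -1. *)
pose c0 := B2 / B0; pose c4 := A2 / A4.
have c0p : 0 < c0 by rewrite divr_gt0.
have c4p : 0 < c4 by rewrite divr_gt0.
pose M := mx3 (c0^-1 *: p k0) (p k2) (c4^-1 *: p k4).
exists (A0 * c0 / A2), (B4 * c4 / B2), M.
exists (fun i => nth 0 [:: c0; A2; 1; B2; c4] i).
have nz (x : R) : 0 < x -> x != 0 by apply: lt0r_neq0.
split.
- split; rewrite ?divr_gt0 ?mulr_gt0 ?invr_gt0 //.
  rewrite [ltRHS](_ : _ = (A0 * B4) / (A4 * B0)).
    by rewrite ltr_pdivlMr ?mul1r ?mulr_gt0.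
  by rewrite /c0 /c4; field; rewrite !nz.
- rewrite unitmxE unitfE -[\det _]/(wedge3 _ _ _) -[p k2]scale1r wedge3_scale.
  rewrite -/(o _ _ _) !mulf_neq0 ?invr_eq0 ?oner_eq0 //; exact: nz.
- by apply: ord5_ind => //=.
- apply: ord5_ind; rewrite -/(p _) !stdE /= mul_vec3 ?p1E ?p3E;
    apply: row3P; rewrite !mxE /c0 /c4; field; rewrite ?nz //.
Qed.

End Transport.

(** * Positive solutions of the recurrence *)

Section Recurrence.
Variable R : realType.

(* The ratios [r k = z k.+1 / z k] satisfy
   [r k * (1 + K * r k.+1 * (1 + r k.+2)) = 1], so their supremum [M] and
   infimum [m] satisfy
   [M * (1 + K * m * (1 + m)) <= 1 <= m * (1 + K * M * (1 + M))],
   which forces [m = M]. *)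
Lemma positive_recurrence (K : R) (z : nat -> R) :
  0 < K -> (forall k, 0 < z k) ->
  (forall k, z k = z k.+1 + K * z k.+2 + K * z k.+3) ->
  exists m, [/\ 0 < m, z 1%N = m * z 0%N & m * (1 + K * m * (1 + m)) = 1].
Proof.
move=> K0 z0 rec; pose r k := z k.+1 / z k.
have zn k : z k != 0 by apply: lt0r_neq0.
have r_gt0 k : 0 < r k by rewrite divr_gt0.
have r_ge0 k : 0 <= r k by apply: ltW.
have K_ge0 : 0 <= K by apply: ltW.
have rE k : r k * (1 + K * r k.+1 * (1 + r k.+2)) = 1.
  transitivity ((z k.+1 + K * z k.+2 + K * z k.+3) / z k).
    by rewrite /r; field; rewrite !zn.
  by rewrite -rec divff.
have zr k : z k.+1 = r k * z k by rewrite divfK.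
clearbody r.
have r_lt1 k : r k <= 1.
  rewrite -(rE k) ler_peMr // lerDl.
  by rewrite !mulr_ge0 ?addr_ge0 ?ler01.
pose E := fun x : R => exists k, x = r k.
have ubE : classical_sets.has_ubound E by exists 1 => _ [k ->].
have lbE : classical_sets.has_lbound E by exists 0 => _ [k ->]; apply: ltW.
have neE : classical_sets.nonempty E by exists (r 0%N), 0%N.
set M := sup E; set m := inf E.
have rM k : r k <= M by apply: ub_le_sup => //; exists k.
have mr k : m <= r k by apply: ge_inf => //; exists k.
have m_ge0 : 0 <= m by apply: lb_le_inf => // _ [k ->]; apply: ltW.
have M_gt0 : 0 < M by apply: lt_le_trans (rM 0%N).
have M_ge0 : 0 <= M by apply: ltW.
have cM : M * (1 + K * m * (1 + m)) <= 1.
  have c_gt0 : 0 < 1 + K * m * (1 + m).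
    by rewrite ltr_wpDr // !mulr_ge0 ?addr_ge0 ?ler01.
  rewrite -ler_pdivlMr // mul1r; apply: ge_sup => // _ [k ->].
  rewrite -[X in _ <= X]mul1r ler_pdivlMr // -[X in _ <= X](rE k).
  rewrite ler_pM2l // lerD2l.
  rewrite -!mulrA ler_pM2l //.
  by apply: ler_pM; rewrite ?addr_ge0 ?ler01 ?lerD2l.
have cm : 1 <= m * (1 + K * M * (1 + M)).
  have c_gt0 : 0 < 1 + K * M * (1 + M).
    by rewrite ltr_wpDr // !mulr_ge0 ?addr_ge0 ?ler01.
  rewrite -ler_pdivrMr // mul1r; apply: lb_le_inf => // _ [k ->].
  rewrite -[X in X <= _]mul1r ler_pdivrMr // -[X in X <= _](rE k).
  rewrite ler_pM2l // lerD2l -!mulrA ler_pM2l //.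
  by apply: ler_pM; rewrite ?addr_ge0 ?ler01 ?lerD2l ?(ltW (r_gt0 _)).
have mM : m = M.
  apply/eqP; rewrite eq_le (le_trans (mr 0%N) (rM 0%N)) /= leNgt.
  apply/negP => lt_mM.
  (* Comparing [cM] with [cm] gives M - m <= K m M (M - m), whereas [cM] alone gives K m M < 1. *)
  have h1 : 0 <= (K * m * M - 1) * (M - m) by nra.
  have h2 : K * m * M < 1.
    have h3 : 0 <= K * m * M * m by rewrite !mulr_ge0.
    by nra.
  have : 0 < (1 - K * m * M) * (M - m) by rewrite mulr_gt0 ?subr_gt0.
  by lra.
exists M; split=> //; last first.
  by apply/eqP; rewrite eq_le -{2 3 4}mM cM mM -{1}mM cm.
have /eqP-> : M == r 0%N by rewrite eq_le rM -mM mr.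
exact: zr.
Qed.

(** The two equations differ by m - m' times a positive factor. Hence the ratios found at different
    vertices agree. *)
Lemma positive_root_unique (K m m' : R) : 0 < K -> 0 < m -> 0 < m' ->
  m * (1 + K * m * (1 + m)) = 1 -> m' * (1 + K * m' * (1 + m')) = 1 -> m = m'.
Proof.
move=> K0 m0 m'0 e e'.
have : (m - m') * (1 + K * (m + m') + K * (m ^+ 2 + m * m' + m' ^+ 2)) = 0.
  transitivity (m * (1 + K * m * (1 + m)) - m' * (1 + K * m' * (1 + m'))).
    by ring.
  by rewrite e e' subrr.
move/eqP; rewrite mulf_eq0 => /orP[/eqP|/eqP c0]; first by move/subr0_eq.
suff : 0 < 1 + K * (m + m') + K * (m ^+ 2 + m * m' + m' ^+ 2).
  by rewrite c0 ltxx.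
by rewrite !addr_gt0 ?mulr_gt0 ?addr_gt0 ?exprn_gt0 ?mulr_gt0.
Qed.

End Recurrence.

(** * The line at infinity, and matrices with zero adjugate *)

Section AtInfinity.
Variable R : realType.

Definition zcoord : 'cV[R]_3 := delta_mx ord_max 0.

Lemma zcoord_neq0 : zcoord != 0.
Proof.
apply/eqP=> /matrixP/(_ ord_max 0)/eqP.
by rewrite !mxE !eqxx oner_eq0.
Qed.

Lemma mul_zcoord (v : 'rV[R]_3) : v *m zcoord = (v 0 ord_max)%:M.
Proof. by rewrite -colE; apply/matrixP=> i j; rewrite !ord1 !mxE eqxx. Qed.

Lemma wedge3_infinity (p q : 'rV[R]_2) (u : 'rV[R]_3) : u 0 ord_max = 0 ->
  wedge3 (homog p) u (homog q) =
  u 0 ord0 * (q - p) 0 ord_max - u 0 ix1 * (q - p) 0 ord0.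
Proof. by move=> u2; rewrite wedge3E !homogE u2 !mxE; ring. Qed.

(** All vertices have third coordinate 1, so the third coordinate of the image is minus the sum of
    the ratios. Each numerator pairs [u] with a short diagonal by the area form, and each
    denominator is twice a signed area. *)
Lemma glick_infinity (P : 'I_5 -> 'rV[R]_2) : convex P ->
  exists2 e : R, e != 0 & forall u : 'rV[R]_3, u 0 ord_max = 0 ->
    glick (fun i => homog (P i)) u 0 ord_max =
    e * (u 0 ord0 * diagonal_sum P 0 ord_max - u 0 ix1 * diagonal_sum P 0 ord0).
Proof.
move=> /orient_sign[s s0 sE]; exists (- (2 * s)^-1) => [|u u2].
  by rewrite oppr_eq0 invr_eq0 mulf_neq0 // pnatr_eq0.
rewrite /glick /diagonal_sum !mxE u2 mulr0 add0r !summxE mulNr.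
congr (- _); rewrite !mulr_sumr -sumrB mulr_sumr; apply: eq_bigr => i _.
rewrite mxE homog2 mulr1 wedge3_infinity // -orientE.
have [oE o0] := sE i; rewrite oE /short_diagonal /vertex_area /triangle_area.
set d := P _ - _; rewrite !mxE.
have a0 : `|orient (P (ord_pred i)) (P i) (P (ordS i))| != 0.
  by rewrite normr_eq0.
by field; rewrite a0 s0.
Qed.

Lemma adj0_minor (X : 'M[R]_3) (i j : 'I_3) : \adj X = 0 ->
  X (lift i ord0) (lift j ord0) * X (lift i ord_max) (lift j ord_max) =
  X (lift i ord0) (lift j ord_max) * X (lift i ord_max) (lift j ord0).
Proof.
move=> /matrixP/(_ j i)/eqP; rewrite 2!mxE /cofactor mulf_eq0 signr_eq0.
by rewrite det2 !mxE subr_eq0 => /eqP.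
Qed.

(** All 2 x 2 minors of [X] vanish, so its rank is at most one and the two images are dependent. *)
Lemma adj0_wedge3 (X : 'M[R]_3) (u v w : 'rV[R]_3) : \adj X = 0 ->
  wedge3 (u *m X) (v *m X) w = 0.
Proof.
move=> X0; have m i j := adj0_minor i j X0.
have rows (i : 'I_3) : wedge3 (row (lift i (ord0 : 'I_2)) X)
      (row (lift i (ord_max : 'I_2)) X) w = 0.
  have := m i ord0; have := m i ix1; have := m i ord_max.
  rewrite !lift3E wedge3E ![row _ _ _ _]mxE.
  set p := lift i _; set q := lift i _ => m2 m1 m0.
  transitivity (w 0 ord_max * (X p ord0 * X q ix1 - X p ix1 * X q ord0)
    - w 0 ix1 * (X p ord0 * X q ord_max - X p ord_max * X q ord0)
    + w 0 ord0 * (X p ix1 * X q ord_max - X p ord_max * X q ix1)).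
    by ring.
  by rewrite m0 m1 m2 !subrr; ring.
have := rows ord0; have := rows ix1; have := rows ord_max.
rewrite !lift3E => r2 r1 r0.
(* A Cauchy-Binet expansion of the left side in the minors of [u] and [v]. *)
transitivity
  ((u 0 ord0 * v 0 ix1 - u 0 ix1 * v 0 ord0)
     * wedge3 (row ord0 X) (row ix1 X) w
   + (u 0 ord0 * v 0 ord_max - u 0 ord_max * v 0 ord0)
     * wedge3 (row ord0 X) (row ord_max X) w
   + (u 0 ix1 * v 0 ord_max - u 0 ord_max * v 0 ix1)
     * wedge3 (row ix1 X) (row ord_max X) w); last first.
  by rewrite r0 r1 r2; ring.
rewrite !wedge3E ![row _ _ _ _]mxE ![(_ *m _) _ _]mxE !sum_ord3.
by ring.
Qed.

End AtInfinity.

(** * The four conditions as an eigenvector condition *)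

Section Pentagon.
Variables (R : realType) (a b : R) (P : 'I_5 -> 'rV[R]_2).
Variables (M : 'M[R]_3) (c : 'I_5 -> R).
Hypotheses (a_gt0 : 0 < a) (b_gt0 : 0 < b) (ab_gt1 : 1 < a * b).
Hypotheses (M_unit : M \in unitmx) (c_gt0 : forall i, 0 < c i).
Hypothesis PE : forall i, homog (P i) = c i *: (std a b i *m M).

Local Notation s := (std a b).
Local Notation W := (starW a b).
Local Notation Y := (starW a b - 1%:M).
Local Notation Q := (polarity a b).
Local Notation lambda := (M *m zcoord R).

(** [lambda] is the line at infinity written in the normal coordinates; all four conditions are
    compared with this one. *)
Definition eigen_infinity : Prop := exists m, W *m lambda = m *: lambda.

Lemma lambda_neq0 : lambda != 0.
Proof.
apply: contra_neq (zcoord_neq0 R) => l0.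
by rewrite -[zcoord R](mulKmx M_unit) l0 mulmx0.
Qed.

Lemma std_lambda i : s i *m lambda = (c i)^-1%:M.
Proof.
have ci0 : c i != 0 by apply: lt0r_neq0.
apply: (scalerI ci0); rewrite mulmxA scalemxAl -PE mul_zcoord homog2.
by rewrite scale_scalar_mx divff.
Qed.

Lemma std_lambda_gt0 i : 0 < (s i *m lambda) 0 0.
Proof. by rewrite std_lambda mxE eqxx invr_gt0. Qed.

(** * Glick's operator of the pentagon *)

Lemma glick_pentagon u : glick (fun i => homog (P i)) u =
  u *m (invmx M *m (W + 3%:M) *m M).
Proof.
have c0 i : c i != 0 by apply: lt0r_neq0.
have := glick_mulmx (u *m invmx M) M_unit c0 PE.
by rewrite mulmxKV // glick_std // !mulmxA.
Qed.

Lemma eigen_infinity_gt0 m : W *m lambda = m *: lambda -> 0 < m.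
Proof.
move=> Wl; rewrite -(pmulr_lgt0 _ (std_lambda_gt0 k0)).
have -> : m * (s k0 *m lambda) 0 0 = (s k0 *m W *m lambda) 0 0.
  by rewrite -mulmxA Wl -scalemxAr [RHS]mxE.
rewrite std0_starW mulmxDl -!scalemxAl mxE [X in X + _]mxE [X in _ + X]mxE.
by rewrite addr_gt0 // !mulr_gt0 ?std_lambda_gt0 ?invr_gt0 ?subr_gt0 //
  addr_gt0.
Qed.

Lemma affine_of_eigen : eigen_infinity ->
  affine_operator (glick (fun i => homog (P i))).
Proof.
move=> [m Wl]; have m_gt0 := eigen_infinity_gt0 Wl.
(* The positivity of [m] makes this constant nonzero. *)
exists (m + 3) => [|v]; first by rewrite lt0r_neq0 ?addr_gt0.
have : glick (fun i => homog (P i)) v *m zcoord R = (m + 3) *: (v *m zcoord R).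
  rewrite glick_pentagon -!mulmxA mulmxDl Wl mul_scalar_mx -scalerDl.
  by rewrite -!scalemxAr mulKmx.
by rewrite !mul_zcoord => /matrixP/(_ 0 0); rewrite !mxE.
Qed.

(** The third coordinate of the image is a covector vanishing on the line at infinity, hence a
    multiple of [zcoord]; in normal coordinates this is an eigenvector equation for [W + 3]. The
    hypothesis is the form in which both [diagonal_sum P = 0] and affineness are exploited. *)
Lemma eigen_of_infinity :
  (forall u : 'rV[R]_3, u 0 ord_max = 0 ->
     glick (fun i => homog (P i)) u 0 ord_max = 0) ->
  eigen_infinity.
Proof.
move=> inf; have [u|t Gt] := @covector_colinear R (zcoord R)
    (invmx M *m (W + 3%:M) *m M *m zcoord R) (zcoord_neq0 R).
  rewrite mul_zcoord => /matrixP/(_ 0 0); rewrite !mxE /= => /inf.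
  by rewrite mulmxA -glick_pentagon mul_zcoord => ->; rewrite raddf0.
exists (t - 3); rewrite scalerBl scalemxAr -Gt -!mulmxA mulKVmx //.
by rewrite mulmxDl mul_scalar_mx addrK.
Qed.

(** * The inscribed and circumscribed conics *)

Lemma polar_std_neq0 i : invmx M *m (Q *m (s i)^T) != 0.
Proof.
have uQ : invmx M *m Q \in unitmx.
  by rewrite unitmx_mul unitmx_inv M_unit polarity_unit.
rewrite mulmxA; apply/eqP=> /(congr1 (mulmx (invmx (invmx M *m Q)))).
rewrite mulKmx // mulmx0 => /(congr1 trmx); rewrite trmxK trmx0 => si0.
by have := std_lambda_gt0 i; rewrite si0 mul0mx mxE ltxx.
Qed.

Lemma std_polarity_opp i : s i *m Q *m (s (ordS (ordS (ordS i))))^T = 0.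
Proof.
set j := ordS (ordS (ordS i)).
have -> : i = ordS (ordS j).
  by rewrite /j; move: i {j}; apply: ord5_ind; rewrite !ordS5.
apply: trmx_inj.
by rewrite trmx0 !trmx_mul trmxK polarity_sym mulmxA std_polarity.
Qed.

(** The vertex opposite to side i is i + 3, which is [Q]-orthogonal to both ends of that side. *)
Lemma side_line_of i :
  side (proj_polygon P) i =
  line_of (invmx M *m (Q *m (s (ordS (ordS (ordS i))))^T)).
Proof.
have c0 j : c j != 0 by apply: lt0r_neq0.
rewrite /side /proj_polygon; apply/esym.
apply: (line_of_join (r := homog (P (ordS (ordS i))))).
- rewrite !PE wedge3_scale wedge3_mulmx !mulf_neq0 //.
    apply: lt0r_neq0; apply: std_wedge_gt0 => //.
      by move: i; apply: ord5_ind; rewrite !ordS5.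
    by move: i; apply: ord5_ind; rewrite !ordS5.
  by rewrite -unitfE -unitmxE.
- exact: polar_std_neq0.
- by rewrite PE -scalemxAl mulmxA mulmxK // mulmxA std_polarity_opp scaler0.
- by rewrite PE -scalemxAl mulmxA mulmxK // mulmxA std_polarity scaler0.
Qed.

Lemma circ_on i : s i *m (Y *m Q) *m (s i)^T = 0.
Proof.
rewrite starW_polarity //.
apply/matrixP=> j k; rewrite !ord1 {j k} mxE sum_ord3 ![_^T _ _]mxE [RHS]mxE.
by move: i; apply: ord5_ind; rewrite !stdE mul_vec3 !vec3_lin !vec3E; ring.
Qed.

(** The three coordinate vertices annihilate the diagonal, and the other two vertices give two
    independent linear equations on the three remaining entries. *)
Lemma circ_unique (X : 'M[R]_3) : X^T = X ->
  (forall i, s i *m X *m (s i)^T = 0) -> exists t, X = t *: (Y *m Q).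
Proof.
move=> symX on; have r0 : a * b - 1 != 0 by rewrite lt0r_neq0 // subr_gt0.
have X10 : X ix1 ord0 = X ord0 ix1 by rewrite -{1}symX mxE.
have X20 : X ord_max ord0 = X ord0 ord_max by rewrite -{1}symX mxE.
have X21 : X ord_max ix1 = X ix1 ord_max by rewrite -{1}symX mxE.
have {}on i : (s i *m X *m (s i)^T) 0 0 = 0 by rewrite on mxE.
have {}on x y z : (exists i, s i = vec3 x y z) ->
    x ^+ 2 * X ord0 ord0 + y ^+ 2 * X ix1 ix1 + z ^+ 2 * X ord_max ord_max
    + 2 * (x * y * X ord0 ix1 + x * z * X ord0 ord_max + y * z * X ix1 ord_max)
    = 0.
  move=> [i sE]; rewrite -[RHS](on i) sE mxE sum_ord3 ![_^T _ _]mxE.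
  by rewrite ![(_ *m X) _ _]mxE !sum_ord3 !vec3E X10 X20 X21; ring.
have X00 : X ord0 ord0 = 0.
  by have := on 1 0 0 (ex_intro _ k0 erefl); rewrite !(expr1n, expr0n) /=; lra.
have X11 : X ix1 ix1 = 0.
  by have := on 0 1 0 (ex_intro _ k2 erefl); rewrite !(expr1n, expr0n) /=; lra.
have X22 : X ord_max ord_max = 0.
  by have := on 0 0 1 (ex_intro _ k4 erefl); rewrite !(expr1n, expr0n) /=; lra.
have X12 : X ix1 ord_max = a * X ord0 ix1 - a * X ord0 ord_max.
  have := on a 1 (-1) (ex_intro _ k1 erefl); rewrite X00 X11 X22.
  by move=> e; apply/eqP; rewrite -subr_eq0; apply/eqP; lra.
have X01 : X ord0 ix1 = b * (a + 1) * (X ord0 ord_max / (a * b - 1)).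
  have := on (-1) 1 b (ex_intro _ k3 erefl); rewrite X00 X11 X22 X12 => e.
  apply: (mulfI r0); transitivity (b * (a + 1) * X ord0 ord_max); last by field.
  by apply/eqP; rewrite -subr_eq0; apply/eqP; lra.
exists (X ord0 ord_max / (a * b - 1)); rewrite starW_polarity //.
apply/matrixP=> i j; rewrite mxE; move: i j; do 2!apply: ord3_ind;
  rewrite mx3E vec3E ?X10 ?X20 ?X21 ?X00 ?X11 ?X22 ?X12 ?X01; by field.
Qed.

Lemma conj_sym (C : 'M[R]_3) : C^T = C -> (M *m C *m M^T)^T = M *m C *m M^T.
Proof. by move=> symC; rewrite !trmx_mul trmxK symC mulmxA. Qed.

Lemma conj_inj (C C' : 'M[R]_3) :
  M *m C *m M^T = M *m C' *m M^T -> C = C'.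
Proof.
have MT : M^T \in unitmx by rewrite unitmx_tr.
by move=> /(can_inj (mulmxK MT))/(can_inj (mulKmx M_unit)).
Qed.

Lemma circumscribed_iff (C : 'M[R]_3) : C^T = C ->
  circumscribed P C <-> exists t, M *m C *m M^T = t *: (Y *m Q).
Proof.
move=> symC; have on i : on_conic C (homog (P i)) <->
    s i *m (M *m C *m M^T) *m (s i)^T = 0.
  rewrite /on_conic PE linearZ /= -!scalemxAl -!scalemxAr trmx_mul !mulmxA.
  split=> [/eqP|->]; last by rewrite !scaler0.
  by rewrite !scaler_eq0 !(negPf (lt0r_neq0 (c_gt0 i))) => /eqP.
split=> [cC|[t tE] i].
  by apply: circ_unique => [|i]; [exact: conj_sym|apply/on].
by apply/on; rewrite tE -scalemxAr -scalemxAl circ_on scaler0.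
Qed.

(** The dual of [invmx Y *m Q] is [invmx Q *m Y], and the polarity [Q], which exchanges sides and
    opposite vertices, carries it to the circumscribed conic [Y *m Q]. *)
Lemma inscribed_of (C : 'M[R]_3) t : t != 0 ->
  M *m C *m M^T = t *: (invmx Y *m Q) -> inscribed P C.
Proof.
move=> t0 tE i; rewrite side_line_of; set u := s _.
have uY : Y \in unitmx by apply: starW1_unit.
have uQ : Q \in unitmx by apply: polarity_unit.
(* The point of tangency in normal coordinates, namely the pole of the side. *)
pose z := t^-1 *: (invmx Q *m Y *m Q *m u^T).
have Xz : M *m C *m M^T *m z = Q *m u^T.
  rewrite tE /z -scalemxAr -scalemxAl scalerA mulVf // scale1r !mulmxA.
  by rewrite mulmxK // mulVmx // mul1mx.
have Cz : C *m (M^T *m z) = invmx M *m (Q *m u^T).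
  by rewrite -Xz !mulmxA mulVmx // mul1mx.
exists (M^T *m z)^T; rewrite /polar trmxK Cz; split=> //.
  apply: contraTneq (polar_std_neq0 (ordS (ordS (ordS i)))) => v0.
  by rewrite -Cz -[M^T *m z]trmxK v0 trmx0 mulmx0 eqxx.
rewrite /on_conic trmxK -mulmxA Cz trmx_mul trmxK -mulmxA mulKVmx //.
rewrite /z linearZ /= !trmx_mul trmxK polarity_sym -scalemxAl.
apply/eqP; rewrite scaler_eq0; apply/orP; right; apply/eqP.
have := circ_on (ordS (ordS (ordS i))); rewrite -/u => /(congr1 trmx).
rewrite !trmx_mul trmxK trmx0 polarity_sym => h; rewrite -[RHS]h.
by rewrite trmx_inv polarity_sym !mulmxA mulmxKV.
Qed.

(* If [X] is tangent to all sides then [Q *m \adj X *m Q] vanishes on all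
   vertices, so it is a multiple of the circumscribed conic; the multiple is
   nonzero because [\adj X = 0] would make the sides proportional. *)
Lemma inscribed_char (C : 'M[R]_3) : C^T = C -> inscribed P C ->
  exists2 t, t != 0 & M *m C *m M^T = t *: (invmx Y *m Q).
Proof.
move=> symC insC; set X := M *m C *m M^T.
have symX : X^T = X by apply: conj_sym.
have uY : Y \in unitmx by apply: starW1_unit.
have uQ : Q \in unitmx by apply: polarity_unit.
have uMT : M^T \in unitmx by rewrite unitmx_tr.
have tan i : exists z (t : R), [/\ t != 0, z^T *m X *m z = 0 &
    X *m z = t *: (Q *m (s (ordS (ordS (ordS i))))^T)].
  have [v [v0 onv]] := insC i; rewrite side_line_of /polar => lE.
  have [t Cv] := line_of_inj (polar_std_neq0 _) lE.
  have vE : v = (M^T *m (invmx M^T *m v^T))^T by rewrite mulKVmx // trmxK.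
  exists (invmx M^T *m v^T), t; split.
  (* With a zero factor the polar would be the whole space, but it is a side. *)
  - apply: contraNneq (polar_std_neq0 (ordS (ordS (ordS i)))) => t0; apply/eqP.
    apply: mul_row_eq0 => u; apply/eqP.
    by rewrite -mem_line_of lE Cv t0 scale0r mem_line_of mulmx0.
  - rewrite /X trmx_mul trmxK trmx_inv trmxK.
    rewrite -!mulmxA mulKVmx // mulKmx // mulmxA.
    exact: onv.
  - by rewrite /X -mulmxA mulKVmx // -mulmxA Cv -scalemxAr mulKVmx.
have [t adjE] : exists t, Q *m \adj X *m Q = t *: (Y *m Q).
  apply: circ_unique => [|i].
    by rewrite !trmx_mul trmx_adj symX polarity_sym mulmxA.
  have [z [t [t0 zXz Xz]]] := tan (ordS (ordS i)).
  have {}Xz : X *m z = t *: (Q *m (s i)^T).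
    by rewrite Xz; congr (_ *: (_ *m (s _)^T)); move: i {Xz};
      apply: ord5_ind; rewrite !ordS5.
  have zX : z^T *m X = t *: (s i *m Q).
    by rewrite -symX -trmx_mul Xz linearZ /= trmx_mul trmxK polarity_sym.
  apply: (scalerI t0); apply: (scalerI t0); rewrite !scaler0.
  (* This is [\det X] times the value of the conic at its own point [z]. *)
  transitivity (z^T *m X *m \adj X *m (X *m z)).
    by rewrite zX Xz -!scalemxAl -!scalemxAr !mulmxA.
  rewrite -[_ *m X *m _]mulmxA mul_mx_adj mul_mx_scalar -scalemxAl mulmxA zXz.
  by rewrite scaler0.
have X_neq0 : X != 0.
  have [z [t' [t'0 _ Xz]]] := tan k0; apply: contra_eq_neq Xz => ->.
  rewrite mul0mx eq_sym scaler_eq0 negb_or t'0.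
  apply: contra_neq (polar_std_neq0 (ordS (ordS (ordS k0)))) => ->.
  by rewrite mulmx0.
have t_neq0 : t != 0.
  apply/eqP=> t0; have adj0 : \adj X = 0.
    rewrite -[\adj X](mulKmx uQ) -[_ *m \adj X](mulmxK uQ) adjE t0 scale0r.
    by rewrite mul0mx mulmx0.
  have [z0 [t0' [t00 _ Xz0]]] := tan k0; have [z1 [t1 [t10 _ Xz1]]] := tan k1.
  have row (z : 'cV[R]_3) (u : 'rV[R]_3) (c' : R) :
      X *m z = c' *: (Q *m u^T) -> z^T *m X = c' *: (u *m Q).
    by move=> Xz; rewrite -symX -trmx_mul Xz linearZ /= trmx_mul trmxK
      polarity_sym.
  (* Sides 0 and 1 have poles 3 and 4; a zero adjugate would make these dependent, against the
     independence of vertices 3, 4, 0. *)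
  have := adj0_wedge3 z0^T z1^T (1 *: (s k0 *m Q)) adj0.
  rewrite (row _ _ _ Xz0) (row _ _ _ Xz1) wedge3_scale wedge3_mulmx !ordS5.
  apply/eqP; rewrite !mulf_neq0 ?oner_eq0 //; last by rewrite -unitfE -unitmxE.
  by apply: lt0r_neq0; have := @std_wedge_gt0 _ _ _ a_gt0 b_gt0 ab_gt1 k3 k0;
    rewrite !ordS5; apply.
(* Cancelling [Q] in [adjE] and multiplying by [X] expresses [X] through [Q], with no assumption on
   [\det X]. *)
have QX : \det X *: Q = t *: (Y *m X).
  have adjE' : Q *m \adj X = t *: Y.
    by rewrite -[LHS](mulmxK uQ) adjE -scalemxAl mulmxK.
  by rewrite scalemxAl -adjE' -mulmxA mul_adj_mx mul_mx_scalar.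
have XE : X = (\det X / t) *: (invmx Y *m Q).
  rewrite -[X in X = _](mulKmx uY); apply: (scalerI t_neq0).
  by rewrite scalerA mulrC divfK // scalemxAr -QX scalemxAr.
exists (\det X / t) => //; apply: contra_neq X_neq0 => d0.
by rewrite XE d0 scale0r.
Qed.


Lemma center_iff (C : 'M[R]_3) v :
  is_center C v <->
  [/\ C \in unitmx, v != 0 & exists2 t, t != 0 & C *m v^T = t *: zcoord R].
Proof.
split=> [[uC v0 lE]|[uC v0 [t t0 tE]]]; split=> //.
  have [t tE] := line_of_inj (zcoord_neq0 R) (esym lE); exists t => //.
  apply: contra_neq v0 => t0; apply: trmx_inj.
  by rewrite -[v^T](mulKmx uC) tE t0 scale0r mulmx0 trmx0.
by rewrite /polar tE line_ofZ.
Qed.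

Lemma unit_conj (C X : 'M[R]_3) : M *m C *m M^T = X ->
  (C \in unitmx) = (X \in unitmx).
Proof. by move=> <-; rewrite !unitmx_mul unitmx_tr M_unit andbT. Qed.

(** An eigenvector of [W] is one of [Y] and of [invmx Y], so the [Q]-pole of the line at infinity is
    its pole for both conics. *)
Lemma conics_of_eigen : eigen_infinity ->
  exists C D : 'M[R]_3,
    [/\ unique_conic (inscribed P) C, unique_conic (circumscribed P) D &
        concentric C D].
Proof.
move=> [m Wl].
have uY : Y \in unitmx by apply: starW1_unit.
have uQ : Q \in unitmx by apply: polarity_unit.
have uMT : M^T \in unitmx by rewrite unitmx_tr.
pose pull X := invmx M *m X *m invmx M^T.
have pullK X : M *m pull X *m M^T = X.
  by rewrite !mulmxA mulmxV // mul1mx mulmxKV.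
have pull_sym X : X^T = X -> (pull X)^T = pull X.
  by move=> symX; rewrite !trmx_mul symX !trmx_inv trmxK mulmxA.
have symYQ : (Y *m Q)^T = Y *m Q by rewrite starW_polarity // circ_sym.
have symIYQ : (invmx Y *m Q)^T = invmx Y *m Q.
  (* Self-adjointness of [Y] passes to its inverse. *)
  have YQ : Y *m Q = Q *m Y^T by rewrite -[LHS]symYQ trmx_mul polarity_sym.
  have uYT : Y^T \in unitmx by rewrite unitmx_tr.
  rewrite trmx_mul polarity_sym trmx_inv -[RHS](mulmxK uYT).
  by rewrite -(mulmxA (invmx Y)) -YQ mulKmx.
have uIYQ : invmx Y *m Q \in unitmx by rewrite unitmx_mul unitmx_inv uY.
have uYQ : Y *m Q \in unitmx by rewrite unitmx_mul uY.
have unit_neq0 (X : 'M[R]_3) : X \in unitmx -> X != 0.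
  by apply: contraTneq => ->; rewrite unitmxE det0 unitr0.
have conic X : X^T = X -> X \in unitmx -> is_conic (pull X).
  move=> symX uX; split; first exact: pull_sym.
  by apply: unit_neq0; rewrite (unit_conj (pullK X)).
have scaled X C' t : C' != 0 -> M *m C' *m M^T = t *: X ->
    exists2 c' : R, c' != 0 & C' = c' *: pull X.
  move=> C'0 tE; have C'E : C' = t *: pull X.
    by apply: conj_inj; rewrite -scalemxAr -scalemxAl pullK.
  by exists t => //; apply: contra_neq C'0 => t0; rewrite C'E t0 scale0r.
exists (pull (invmx Y *m Q)), (pull (Y *m Q)); split.
- split; first exact: conic.
    by apply: (@inscribed_of _ 1); rewrite ?oner_eq0 // pullK scale1r.
  by move=> C' [symC' C'0] /(inscribed_char symC')[t _ /(scaled _ _ _ C'0)].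
- split; first exact: conic.
    apply/circumscribed_iff; first exact: pull_sym.
    by exists 1; rewrite pullK scale1r.
  by move=> C' [symC' C'0] /(circumscribed_iff symC')[t /(scaled _ _ _ C'0)].
have Yl : Y *m lambda = (m - 1) *: lambda.
  by rewrite mulmxBl mul1mx Wl scalerBl scale1r.
have m1 : m - 1 != 0.
  apply: contra_neq lambda_neq0 => m1.
  by rewrite -[lambda](mulKmx uY) Yl m1 scale0r mulmx0.
have IYl : invmx Y *m lambda = (m - 1)^-1 *: lambda.
  by apply: (scalerI m1); rewrite scalerA mulfV // scale1r scalemxAr -Yl mulKmx.
(* The common center, transported from normal coordinates. *)
pose z := M^T *m (invmx Q *m lambda).
have z0 : z^T != 0.
  apply: contra_neq lambda_neq0 => /(congr1 trmx); rewrite trmxK trmx0 /z => z0.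
  by rewrite -[lambda](mulKVmx uQ) -[invmx Q *m _](mulKmx uMT) z0 !mulmx0.
have pullz X : pull (X *m Q) *m z = invmx M *m (X *m lambda).
  by rewrite /pull /z -!mulmxA mulKmx // mulKVmx.
exists z^T; apply/center_iff; rewrite trmxK; split=> //.
- by rewrite (unit_conj (pullK _)).
- by exists (m - 1)^-1; rewrite ?invr_eq0 // pullz IYl -scalemxAr mulKmx.
- by rewrite (unit_conj (pullK _)).
- by exists (m - 1) => //; rewrite pullz Yl -scalemxAr mulKmx.
Qed.

(* Concentricity says that [Y *m Y *m lambda = rho *: lambda] for some [rho]; by
   [starW_char] this determines [W *m lambda] up to the factor
   [1 + rho - kappa], whose vanishing would give [2 *: lambda = 0]. *)
Lemma eigen_of_conics (C D : 'M[R]_3) :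
  is_conic C -> is_conic D -> inscribed P C -> circumscribed P D ->
  concentric C D -> eigen_infinity.
Proof.
move=> [symC _] [symD _] /(inscribed_char symC)[t t0 CE].
move=> /(circumscribed_iff symD)[t' DE] [v /center_iff[uC v0 [p p0 Cv]]].
move=> /center_iff[uD _ [q q0 Dv]].
have uY : Y \in unitmx by apply: starW1_unit.
have uMT : M^T \in unitmx by rewrite unitmx_tr.
pose z := invmx M^T *m v^T.
have Mz (X : 'M[R]_3) : M *m X *m M^T *m z = M *m (X *m v^T).
  by rewrite /z -mulmxA mulKVmx // mulmxA.
(* The inscribed conic determines the center; inserting it into the equation of the circumscribed
   one gives [Y2]. *)
have Qz : Q *m z = (t^-1 * p) *: (Y *m lambda).
  have := Mz C; rewrite CE Cv -scalemxAl -!scalemxAr -mulmxA.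
  move=> /(congr1 (mulmx Y)); rewrite -!scalemxAr mulKVmx // => e.
  by rewrite -scalerA -e scalerA mulVf // scale1r.
have Y2 : exists rho, Y *m (Y *m lambda) = rho *: lambda.
  have := Mz D; rewrite DE Dv -scalemxAl -!scalemxAr -mulmxA Qz -scalemxAr.
  rewrite scalerA => e; exists ((t' * (t^-1 * p))^-1 * q).
  rewrite -scalerA -e scalerA mulVf ?scale1r //.
  apply: contra_neq lambda_neq0 => r0; apply: (scalerI q0).
  by rewrite -e r0 scale0r scaler0.
have [rho {}Y2] := Y2.
have W2 : W *m (W *m lambda) = 2 *: (W *m lambda) + (rho - 1) *: lambda.
  move: Y2; rewrite mulmxBl mul1mx mulmxBl mul1mx mulmxBr => Y2.
  apply/matrixP=> i j; move/matrixP/(_ i j): Y2.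
  set ww := W *m (W *m _); set w := W *m _; set l := M *m _; rewrite !mxE; lra.
(* The cube of [W] at [lambda] is reduced in two ways, by [W2] and by [starW_char_mul]. *)
have key : (1 + rho - kappa a b) *: (W *m lambda) =
    (kappa a b + 1 - rho) *: lambda.
  have W3 := starW_char_mul ab_gt1 lambda.
  move: W3; rewrite W2 mulmxDr -!scalemxAr W2 => W3.
  apply/matrixP=> i j; move/matrixP/(_ i j): W3.
  set w := W *m _; set l := M *m _; rewrite !mxE; lra.
have d0 : 1 + rho - kappa a b != 0.
  apply: contra_neq lambda_neq0 => d0; apply/eqP; move/eqP: key.
  rewrite d0 scale0r eq_sym scaler_eq0 (_ : kappa a b + 1 - rho = 2).
    by rewrite pnatr_eq0.
  lra.
exists ((1 + rho - kappa a b)^-1 * (kappa a b + 1 - rho)).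
by rewrite -scalerA -key scalerA mulVf // scale1r.
Qed.

(** * Iterates of the inverse pentagram map *)

Definition star_frame k : 'M[R]_3 := iter k (mulmx (invmx W)) M.

Let W_unit : W \in unitmx. Proof. exact: starW_unit. Qed.

Lemma star_frame_unit k : star_frame k \in unitmx.
Proof. by elim: k => //= k IHk; rewrite unitmx_mul unitmx_inv W_unit. Qed.

Lemma star_frameS k : W *m star_frame k.+1 = star_frame k.
Proof. exact: mulKVmx. Qed.

(** Joins and meets commute with linear maps, so each step is [star_tip] read in the current frame:
    the frame gains a factor [invmx W] and the labels move by [shift3]. *)
Lemma iter_inverse_pentagram k i :
  iter k (@inverse_pentagram R 5) (proj_polygon P) i =
  <[s (iter k (@shift3 5) i) *m star_frame k]>%VS.
Proof.
elim: k i => [|k IHk] i.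
  by rewrite /= /proj_polygon PE vlineZ // lt0r_neq0.
rewrite iterS /inverse_pentagram /side !IHk ord_predK !iter_shift3_ordS.
rewrite iter_shift3_pred [iter k.+1 _ _]iterS; move: (iter k _ i) => {i IHk} j.
have [x [y [p [q [q0 e tip]]]]] := star_tip a_gt0 b_gt0 ab_gt1 j.
have {}tip : s (shift3 j) *m star_frame k.+1 =
    (x *: s (ord_pred j) + y *: s j) *m star_frame k.
  by rewrite -tip -mulmxA star_frameS.
have tip' := tip; rewrite e in tip'.
rewrite mulmxDl -!scalemxAl in tip; rewrite mulmxDl -!scalemxAl in tip'.
apply: (meet_joins _ q0 tip tip').
rewrite wedge3_mulmx mulf_neq0 //.
  apply: lt0r_neq0; rewrite -{2}[j]ord_predK; apply: std_wedge_gt0 => //.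
    by move: j {e tip tip'}; apply: ord5_ind; rewrite !ord5E.
  by move: j {e tip tip'}; apply: ord5_ind; rewrite !ord5E.
by rewrite -unitfE -unitmxE star_frame_unit.
Qed.

(** The covectors of the iterates are positive multiples of [lambda], so all vertices are finite,
    and dividing by positive third coordinates preserves the orientations of [std]. *)
Lemma iterates_convex_of_eigen k : eigen_infinity ->
  convex_in_affine_plane
    (iter k (@inverse_pentagram R 5) (proj_polygon P)).
Proof.
move=> [m Wl]; have m_gt0 := eigen_infinity_gt0 Wl.
(* Here [h] is the k-th power of [m^-1]. *)
have [h h_gt0 Xl] : exists2 h, 0 < h & star_frame k *m zcoord R = h *: lambda.
  elim: k => [|k [h h_gt0 IHk]]; first by exists 1; rewrite ?scale1r.
  exists (h / m); first by rewrite divr_gt0.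
  rewrite -[LHS](mulKmx W_unit) (mulmxA W) star_frameS IHk -scalemxAr -scalerA.
  congr (_ *: _); apply: (scalerI (lt0r_neq0 m_gt0)).
  by rewrite scalerA divff ?lt0r_neq0 // scale1r scalemxAr -Wl mulKmx.
set t := iter k (@shift3 5); set X := star_frame k in Xl *.
pose z i := h * (s (t i) *m lambda) 0 0.
have z_gt0 i : 0 < z i by rewrite mulr_gt0 // std_lambda_gt0.
have /fin_all_exists[P' P'E] : forall i, exists p,
    homog p = (z i)^-1 *: (s (t i) *m X).
  move=> i; apply: affine_point; rewrite mxE.
  have -> : (s (t i) *m X) 0 ord_max = z i.
    have := mul_zcoord (s (t i) *m X); rewrite -mulmxA Xl -scalemxAr.
    by move=> /matrixP/(_ 0 0); rewrite mxE [RHS]mxE eqxx mulr1n => <-.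
  by rewrite mulVf // lt0r_neq0.
exists P' => [i|i].
  have o j : j != i -> j != ordS i ->
      0 < orient (P' i) (P' (ordS i)) (P' j) / \det X.
    move=> ji jSi; rewrite orientE !P'E wedge3_scale wedge3_mulmx mulrA mulfK.
      rewrite !mulr_gt0 ?invr_gt0 // /t iter_shift3_ordS.
      apply: std_wedge_gt0 => //; rewrite -?iter_shift3_ordS;
        by rewrite (inj_eq (@iter_shift3_inj _ k)).
    by rewrite -unitfE -unitmxE star_frame_unit.
  (* The frame may reverse orientation; [convex] admits either sign. *)
  have [d|d] := ltP 0 (\det X); [left|right] => j ji jSi.
    by have := o j ji jSi; rewrite pmulr_lgt0 ?invr_gt0.
  have := o j ji jSi; rewrite nmulr_lgt0 // invr_lt0 lt_neqAle d andbT.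
  by rewrite -unitfE -unitmxE star_frame_unit.
rewrite iter_inverse_pentagram /proj_polygon P'E vlineZ //.
by rewrite invr_eq0 lt0r_neq0.
Qed.

(** Convexity makes the covectors [l k] positive on the vertices, so by [positive_recurrence] they
    shrink by one and the same ratio at every vertex. *)
Lemma eigen_of_iterates :
  (forall k, (0 < k)%N -> convex_in_affine_plane
     (iter k (@inverse_pentagram R 5) (proj_polygon P))) ->
  eigen_infinity.
Proof.
move=> iter_convex; pose l k := star_frame k *m zcoord R.
have Wl k : W *m l k.+1 = l k by rewrite mulmxA star_frameS.
have l_gt0 k i : 0 < (s i *m l k) 0 0.
  elim: k i => [|k IHk] i; first exact: std_lambda_gt0.
  have [P' cP' P'E] := iter_convex k.+1 isT.
  set t := iter k.+1 (@shift3 5); set X := star_frame k.+1.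
  have [g gE] : exists g : 'I_5 -> R, forall j,
      g j != 0 /\ homog (P' j) = g j *: (s (t j) *m X).
    have /fin_all_exists[g gE] : forall j, exists g,
        g != 0 /\ homog (P' j) = g *: (s (t j) *m X).
      move=> j; have := P'E j; rewrite iter_inverse_pentagram => /esym e.
      have nz : homog (P' j) != 0.
        apply/eqP=> /rowP/(_ ord_max)/eqP.
        by rewrite homog2 mxE oner_eq0.
      by have [g g0 gE] := vline_eq nz e; exists g.
    by exists g.
  have gz j : g j * (s (t j) *m l k.+1) 0 0 = 1.
    have := mul_zcoord (homog (P' j)).
    rewrite homog2 (gE j).2 -scalemxAl -mulmxA.
    by move=> /matrixP/(_ 0 0); rewrite mxE [RHS]mxE eqxx.
  (* Vertices j + 2 and j + 3 lie on the same side of side j; the other scaling factors and [\det X]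
     enter both orientations and form a square. *)
  have adj j : 0 < g (ordS (ordS j)) * g (ordS (ordS (ordS j))).
    have := @convex_mul_gt0 R 5 P' j (ordS (ordS j)) (ordS (ordS (ordS j))) cP'.
    rewrite !orientE !(gE _).2 !wedge3_scale !wedge3_mulmx /t !iter_shift3_ordS.
    have ne : (ordS (ordS j) != j) && (ordS (ordS j) != ordS j) &&
        (ordS (ordS (ordS j)) != j) && (ordS (ordS (ordS j)) != ordS j).
      by move: j; apply: ord5_ind; rewrite !ordS5.
    move: ne => /andP[/andP[/andP[n1 n2] n3] n4] /(_ n1 n2 n3 n4).
    have t1 : 0 < wedge3 (s (t j)) (s (ordS (t j))) (s (ordS (ordS (t j)))).
      by apply: std_wedge_gt0 => //; rewrite -?iter_shift3_ordS;
        rewrite (inj_eq (@iter_shift3_inj _ k.+1)).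
    have t2 : 0 < wedge3 (s (t j)) (s (ordS (t j)))
        (s (ordS (ordS (ordS (t j))))).
      by apply: std_wedge_gt0 => //; rewrite -?iter_shift3_ordS;
        rewrite (inj_eq (@iter_shift3_inj _ k.+1)).
    have detX : \det X != 0 by rewrite -unitfE -unitmxE star_frame_unit.
    move: t1 t2 => t1 t2; set w1 := wedge3 _ _ _ in t1 *.
    set w2 := wedge3 _ _ _ in t2 *.
    have pos : 0 < (g j * g (ordS j) * \det X) ^+ 2 * w1 * w2.
      rewrite mulr_gt0 // mulr_gt0 // exprn_even_gt0 //=.
      by rewrite !mulf_neq0 ?(gE _).1.
    rewrite [ltRHS](_ : _ = (g j * g (ordS j) * \det X) ^+ 2 * w1 * w2 *
      (g (ordS (ordS j)) * g (ordS (ordS (ordS j))))); last by ring.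
    by rewrite pmulr_rgt0.
  have g_all j : 0 < g k0 * g j.
    have g1 : 0 < g k0 * g k1 by have := adj k3; rewrite !ordS5.
    have g2 : 0 < g k0 * g k2.
      by apply: mul0lt_trans g1 _; have := adj k4; rewrite !ordS5.
    have g3 : 0 < g k0 * g k3.
      by apply: mul0lt_trans g2 _; have := adj k0; rewrite !ordS5.
    have g4 : 0 < g k0 * g k4.
      by apply: mul0lt_trans g3 _; have := adj k1; rewrite !ordS5.
    move: j; apply: ord5_ind => //.
    by rewrite -expr2 exprn_even_gt0 //= (gE _).1.
  (* Were all the factors negative, [l k.+1] would be negative on the vertices, and then [l k], its
     image by [W], would be so at [std k0], against the induction hypothesis. *)
  have g0 : 0 < g k0.
    rewrite lt_neqAle eq_sym (gE _).1 leNgt; apply/negP => g0.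
    have z_lt0 j : (s j *m l k.+1) 0 0 < 0.
      have [j' <-] := iter_shift3_surj k.+1 j.
      have gj : g j' < 0 by have := g_all j'; rewrite nmulr_rgt0.
      by rewrite -(nmulr_rgt0 _ gj) gz.
    have := IHk k0; rewrite -Wl mulmxA std0_starW.
    rewrite mulmxDl -!scalemxAl mxE [X in X + _]mxE [X in _ + X]mxE.
    apply/negP; rewrite -leNgt -oppr_ge0 opprD -!mulrN addr_ge0 //.
      by rewrite mulr_ge0 ?oppr_ge0 ?(ltW (z_lt0 _)) // ltW //
        !mulr_gt0 ?invr_gt0 ?subr_gt0 ?addr_gt0.
    by rewrite mulr_ge0 ?oppr_ge0 ?(ltW (z_lt0 _)) // ltW.
  have [j <-] := iter_shift3_surj k.+1 i.
  have gj : 0 < g j by have := g_all j; rewrite pmulr_rgt0.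
  by rewrite -(pmulr_rgt0 _ gj) gz.
have K_gt0 := kappa_gt0 a_gt0 b_gt0 ab_gt1.
have ratio i : exists m, [/\ 0 < m, s i *m l 1%N = m *: (s i *m l 0%N) &
    m * (1 + kappa a b * m * (1 + m)) = 1].
  have [|k|m [m_gt0 zE mE]] :=
    positive_recurrence (z := fun k => (s i *m l k) 0 0) K_gt0.
  - by move=> k; apply: l_gt0.
  - have := starW_char_mul ab_gt1 (l k.+3); rewrite !Wl => {1}->.
    by rewrite !mulmxDr -!scalemxAr !mxE.
  exists m; split=> //; apply/matrixP=> x y; rewrite !ord1 zE.
  by rewrite [RHS]mxE.
have [m [m_gt0 e0 mE]] := ratio k0.
have [m2 [m2_gt0 e2 m2E]] := ratio k2; have [m4 [m4_gt0 e4 m4E]] := ratio k4.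
(* Vertices 0, 2 and 4 form a basis, and uniqueness of the positive root equates their ratios. *)
have l1 : l 1%N = m *: l 0%N.
  apply: (@std_ext _ a b); rewrite -scalemxAr //.
    by rewrite e2 (positive_root_unique K_gt0 m_gt0 m2_gt0 mE m2E).
  by rewrite e4 (positive_root_unique K_gt0 m_gt0 m4_gt0 mE m4E).
exists m^-1; apply: (scalerI (lt0r_neq0 m_gt0)).
rewrite scalerA divff ?lt0r_neq0 // scale1r scalemxAr.
by rewrite -[M *m _]/(l 0%N) -l1 Wl.
Qed.

End Pentagon.

Theorem theorem1p3 (R : realType) (P : 'I_5 -> 'rV[R]_2) (hP : convex P) :
  [<-> forall k : nat, (0 < k)%N ->
         convex_in_affine_plane
           (iter k (@inverse_pentagram R 5) (proj_polygon P));
       diagonal_sum P = 0;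
       affine_operator (glick (fun i => homog (P i)));
       exists C D : 'M[R]_3,
         [/\ unique_conic (inscribed P) C,
             unique_conic (circumscribed P) D
           & concentric C D]].
Proof.
have [a [b [M [c [[a0 b0 ab1] uM c0 PE]]]]] := pentagon_normal_form hP.
have [e e0 glickE] := glick_infinity hP.
have infinity_of_affine : affine_operator (glick (fun i => homog (P i))) ->
    forall u : 'rV[R]_3, u 0 ord_max = 0 ->
    glick (fun i => homog (P i)) u 0 ord_max = 0.
  by move=> [d _ dE] u u2; rewrite dE u2 mulr0.
have diagonal_of_affine : affine_operator (glick (fun i => homog (P i))) ->
    diagonal_sum P = 0.
  move=> /infinity_of_affine inf.
  (* The two coordinate directions at infinity read off the two coordinates of the diagonal sum. *)
  have := inf (vec3 1 0 0); have := inf (vec3 0 1 0).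
  rewrite !glickE ?vec3E // !(mul0r, mul1r, sub0r, subr0).
  move=> /(_ erefl)/eqP; rewrite mulf_eq0 oppr_eq0 (negPf e0) => /eqP d0.
  move=> /(_ erefl)/eqP; rewrite mulf_eq0 (negPf e0) => /eqP d1.
  apply/rowP=> -[[|[|//]] lt_i]; rewrite mxE.
    by rewrite -d0; congr (diagonal_sum P 0 _); apply/val_inj.
  by rewrite -d1; congr (diagonal_sum P 0 _); apply/val_inj.
(* The four implications form a cycle, each of them passing through [eigen_infinity]. *)
tfae.
- move=> /(eigen_of_iterates a0 b0 ab1 uM c0 PE) eig.
  exact/diagonal_of_affine/(affine_of_eigen a0 b0 ab1 uM c0 PE eig).
- move=> d0; apply: (affine_of_eigen a0 b0 ab1 uM c0 PE).
  apply: (eigen_of_infinity ab1 uM c0 PE) => u u2.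
  by rewrite glickE // d0 !mxE !mulr0 subrr mulr0.
- move=> /infinity_of_affine inf.
  apply: (conics_of_eigen a0 b0 ab1 uM c0 PE).
  exact: (eigen_of_infinity ab1 uM c0 PE).
- move=> [C [D [[conicC inC _] [conicD onD _] conc]]] k _.
  apply: (iterates_convex_of_eigen a0 b0 ab1 uM c0 PE).
  exact: (eigen_of_conics a0 b0 ab1 uM c0 PE conicC conicD inC onD conc).
Qed.
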